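(* Let $P\subset\mathbb{R}^d$ be a $d$-dimensional Fano polytope. Put $N:=\lceil d/2\rceil$ and $|\partial(0P)\cap\mathbb{Z}^d|:=1$. If $d$ is even, then $P$ is reflexive if and only if $$\sum_{m=0}^{N}(-1)^{N+m}\binom{2N}{N+m}\Big(d\,|mP\cap\mathbb{Z}^d|-(N+m)\,|\partial(mP)\cap\mathbb{Z}^d|\Big)=0.$$ If $d$ is odd, then $P$ is reflexive if and only if $$\sum_{m=0}^{N}(-1)^{N+m}\binom{2N}{N+m}\left(md\,|mP\cap\mathbb{Z}^d|+\Big(N^2-m^2-\frac{md}{2}\Big)|\partial(mP)\cap\mathbb{Z}^d|\right)=0.$$
   Context: A lattice polytope in $\mathbb{R}^d$ is the convex hull of finitely many points of $\mathbb{Z}^d$; $mP$ is the $m$-th dilate (with $0P=\{0\}$), $\partial$ denotes boundary and $P^\circ$ the interior. A $d$-dimensional convex lattice polytope $P$ is called Fano if $P^\circ\cap\mathbb{Z}^d=\{0\}$. It is called reflexive if the dual polyhedron $P^\vee:=\{u\in\mathbb{R}^d\mid\langle u,v\rangle\le 1\text{ for all }v\in P\}$ is also a lattice polytope. *)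

(* Defs.v *)
From mathcomp Require Import all_boot all_order all_algebra finmap.
From mathcomp Require Import all_classical reals topology normedtype convex.

Set Implicit Arguments.
Unset Strict Implicit.
Unset Printing Implicit Defensive.

Import Order.TTheory GRing.Theory Num.Theory.
Import numFieldNormedType.Exports.

Local Open Scope classical_set_scope.
Local Open Scope ring_scope.

Section LatticePolytopes.
Variables (R : realType) (d : nat).
Implicit Types (A P : set 'rV[R]_d).

Definition lattice : set 'rV[R]_d := [set x | x \is a mxOver Num.int].

Definition conv_hull A : set 'rV[R]_d := smallest (@convex_set R 'rV[R]_d) A.

Definition lattice_polytope P : Prop :=
  exists V : set 'rV[R]_d,
    [/\ finite_set V, V `<=` lattice & P = conv_hull V].

(* [U] is the direction space of the affine hull of [A]: the least linear
   subspace containing all the differences of points of [A]. *)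
Definition has_dim A (k : nat) : Prop :=
  A !=set0 /\
  exists2 U : {vspace 'rV[R]_d},
    forall W : {vspace 'rV[R]_d},
      (forall x y, A x -> A y -> x - y \in W) <-> (U <= W)%VS
    & \dim U = k.

Definition fano P : Prop :=
  [/\ lattice_polytope P, has_dim P d & P° `&` lattice = [set 0]].

Definition dual P : set 'rV[R]_d :=
  [set u | forall v, P v -> \sum_(i < d) u 0 i * v 0 i <= 1].

Definition reflexive_polytope P : Prop :=
  fano P /\ lattice_polytope (dual P).

(* For m = 0 and P nonempty this is {0}. *)
Definition dilate (m : nat) P : set 'rV[R]_d := [set m%:R *: x | x in P].

Definition boundary A : set 'rV[R]_d := closure A `\` A°.

(* [fset_set] of an infinite set is empty; here it is only used for bounded
   sets, which have finitely many lattice points. *)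
Definition num_lattice_points A : nat := #|` fset_set (A `&` lattice)|.

(* The value 1 at m = 0 is a convention; it differs from the number of lattice
   points of the topological boundary of {0} only in dimension 0. *)
Definition num_boundary_points P (m : nat) : nat :=
  if m == 0%N then 1%N else num_lattice_points (boundary (dilate m P)).

End LatticePolytopes.

(* Main.v *)
Require Import Defs.
From mathcomp Require Import all_boot all_order all_algebra finmap ring lra zify.
From mathcomp Require Import all_classical reals topology normedtype derive convex.
From mathcomp Require Import interval_inference.

(* Fix a regular triangulation of the fan over the boundary of P whose rays are
   spanned by the given generators, and a generic direction y. Moving points
   infinitesimally along y splits the space into half-open simplicial cones, so
   each lattice point is uniquely p + (natural combination of the generators of
   its cone) with p in one of finitely many half-open boxes. The gauge of P is a
   linear height on each cone, with values r = height p in [0, d] on the boxes;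
   hence the lattice points of mP are counted by the sum over p of
   C(m - ceil r + d, d), and those of its interior by the sum of
   C(m - 1 - floor r + d, d). The symmetry p |-> (sum of generators) - p carries
   the boxes of y to those of -y and replaces r by d - r. The alternating sums
   are finite differences that send the pair C(m - k + d, d), C(m - 1 + k, d) to
   a multiple of 2k - d; averaging k = ceil r and k = d - floor r, the functional
   becomes a positive multiple of the number of p with r not an integer (for
   d > 0). All r are integers exactly when every facet functional is integral,
   that is, when P is reflexive. *)

Set Implicit Arguments.
Unset Strict Implicit.
Unset Printing Implicit Defensive.

Import Order.TTheory GRing.Theory Num.Theory.
Import numFieldNormedType.Exports.

Local Open Scope classical_set_scope.
Local Open Scope ring_scope.

(** * Finite differences of binomial polynomials *)

Section FiniteDifferences.
Variable R : realFieldType.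

(** * The binomial coefficient as a polynomial in its upper argument *)

Definition gbin (r : nat) (x : R) : R := \prod_(i < r) (x - i%:R) / (r`!)%:R.

Lemma fact_neq0 n : n`!%:R != 0 :> R.
Proof. by rewrite pnatr_eq0 -lt0n fact_gt0. Qed.

Lemma gbinS r x : gbin r.+1 x = gbin r x * (x - r%:R) / r.+1%:R.
Proof.
rewrite /gbin big_ord_recr /= factS natrM -natr1.
have h2 := fact_neq0 r; have h1 : r%:R + 1 != 0 :> R by rewrite natr1 pnatr_eq0.
by field; rewrite h1 h2.
Qed.

Lemma gbin_pascal r x : gbin r.+1 (x + 1) - gbin r.+1 x = gbin r x.
Proof.
rewrite [in X in X - _ = _]/gbin big_ord_recl /= subr0.
rewrite (_ : \prod_(i < r) _ = \prod_(i < r) (x - i%:R)); last first.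
  by apply: eq_bigr => i _; rewrite /bump /= add1n -natr1; ring.
rewrite gbinS factS natrM /gbin -natr1.
have h2 := fact_neq0 r; have h1 : r%:R + 1 != 0 :> R by rewrite natr1 pnatr_eq0.
by field; rewrite h1 h2.
Qed.

Lemma gbin_nat r n : gbin r n%:R = 'C(n, r)%:R.
Proof.
elim: r n => [|r IH] n; first by rewrite /gbin big_ord0 bin0 fact0 divr1.
elim: n => [|n IHn]; first by rewrite /gbin big_ord_recl /= subrr !mul0r bin0n /=.
by have := gbin_pascal r n%:R; rewrite natr1 IHn IH binS natrD => <-; ring.
Qed.

(** Binomial reciprocity. It later identifies the interior counts with values of the counting
    polynomial at negative arguments. *)
Lemma gbin_opp r x : gbin r (- x) = (-1) ^+ r * gbin r (x + r%:R - 1).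
Proof.
elim: r x => [|r IH] x; first by rewrite /gbin !big_ord0 expr0 !mul1r.
rewrite gbinS IH exprS.
have -> : gbin r.+1 (x + r.+1%:R - 1) = gbin r (x + r%:R - 1) * (x + r%:R) / r.+1%:R.
  rewrite /gbin big_ord_recl /= factS natrM.
  rewrite (_ : \prod_(i < r) (x + r.+1%:R - 1 - (bump 0 i)%:R)
     = \prod_(i < r) (x + r%:R - 1 - i%:R)); last first.
    by apply: eq_bigr => i _; rewrite /bump /= add1n -!natr1; ring.
  rewrite -natr1.
  have h2 := fact_neq0 r; have h1 : r%:R + 1 != 0 :> R by rewrite natr1 pnatr_eq0.
  by field; rewrite h1 h2.
by ring.
Qed.

(** Up to the sign (-1)^n, the [n]-th forward difference of [f] at 0. *)
Definition altsum (n : nat) (f : nat -> R) : R :=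
  \sum_(j < n.+1) (-1) ^+ j * 'C(n, j)%:R * f j.

Lemma altsumS n f : altsum n.+1 f = altsum n f - altsum n (fun j => f j.+1).
Proof.
rewrite /altsum big_ord_recl /= bin0 !mul1r.
under eq_bigr => i _ do rewrite /bump /= add1n binS natrD mulrDr mulrDl exprS.
rewrite big_split /= addrA; congr (_ + _); last first.
  by rewrite -sumrN; apply: eq_bigr => i _; ring.
rewrite [RHS]big_ord_recl /= bin0 !mul1r; congr (_ + _).
rewrite big_ord_recr /= bin_small // mulr0 mul0r addr0.
by apply: eq_bigr => i _; rewrite /bump /= add1n exprS.
Qed.

Lemma eq_altsum n (f g : nat -> R) : f =1 g -> altsum n f = altsum n g.
Proof. by move=> fg; apply: eq_bigr => i _; rewrite fg. Qed.

(** By Pascal's rule each difference lowers the order of the binomial by one and contributes a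
    sign. *)
Lemma altsum_gbin n r x :
  (n <= r)%N -> altsum n (fun j => gbin r (x + j%:R)) = (-1) ^+ n * gbin (r - n) x.
Proof.
elim: n x => [|n IH] x nr.
  by rewrite /altsum big_ord_recl big_ord0 /= bin0 expr0 addr0 subn0 addr0 !mul1r.
rewrite altsumS IH ?(ltnW nr) //.
rewrite (@eq_altsum _ _ (fun j => gbin r (x + 1 + j%:R))); last first.
  by move=> j; rewrite -addrA nat1r.
by rewrite IH ?(ltnW nr) // -(subnSK nr) -[gbin _ x in RHS]gbin_pascal exprS; ring.
Qed.

Lemma altsum_gbin0 r x : altsum r.+1 (fun j => gbin r (x + j%:R)) = 0.
Proof.
rewrite altsumS altsum_gbin //.
rewrite (@eq_altsum _ _ (fun j => gbin r (x + 1 + j%:R))); last first.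
  by move=> j; rewrite -addrA nat1r.
by rewrite altsum_gbin // subnn /gbin !big_ord0 subrr.
Qed.

(** Pairs the indices symmetric about [N]: in the functionals, [N + m] carries the value of the
    counting polynomial at [m], and [N - m] its value at [- m]. *)
Lemma sum_fold N (H : nat -> R) :
  \sum_(j < N.*2.+1) H j = H N + \sum_(1 <= m < N.+1) (H (N - m)%N + H (N + m)%N).
Proof.
rewrite -(big_mkord xpredT H) (@big_cat_nat _ _ _ N) //=; last by rewrite -addnn; lia.
rewrite (@big_ltn _ _ _ N) //; last by rewrite -addnn; lia.
rewrite addrCA; congr (_ + _); rewrite big_split /=; congr (_ + _).
  rewrite big_nat_rev /= [RHS]big_add1 /=.
  by apply: eq_big_nat => i hi; congr H; lia.
rewrite -{1}(addn0 N.+1) [LHS](_ : _ = \sum_(0 + N.+1 <= i < N + N.+1) H i); last first.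
  by congr bigop; rewrite /index_iota; congr iota; rewrite -?addnn; lia.
rewrite big_addn addnK [RHS]big_add1 /=.
by apply: eq_big_nat => i hi; congr H; lia.
Qed.

End FiniteDifferences.

(** * The two alternating functionals applied to the counts of a single box point *)

Section Functional.
Variables (R : realFieldType) (d : nat).

(* The number of [t] in N^d with [sum t + k <= m]; without the guard, truncated
   subtraction would count [1] when [m < k]. *)
Definition simplex_count (m k : nat) : nat :=
  if (k <= m)%N then 'C(m - k + d, d) else 0%N.

(** For [m < k] the guard gives 0, and so does the polynomial: its argument is then a natural number
    below [d], one of its roots. *)
Lemma simplex_countE m k : (k <= d)%N ->
  (simplex_count m k)%:R = gbin d (m%:R + (d%:R - k%:R)) :> R.
Proof.
move=> kd; rewrite -natrB // -natrD gbin_nat /simplex_count; congr (_%:R).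
case: leqP => km; last by rewrite bin_small //; lia.
by rewrite (_ : m - k + d = m + (d - k))%N //; lia.
Qed.

(** Ehrhart reciprocity for one box point: the shift [k] for a dilate is matched by the shift
    [(d - k).+1] for its interior. *)
Lemma simplex_count_opp m k : (k <= d)%N ->
  (simplex_count m.+1 (d - k).+1)%:R
  = (-1) ^+ d * gbin d (- m.+1%:R + (d%:R - k%:R)) :> R.
Proof.
move=> kd; have -> : - m.+1%:R + (d%:R - k%:R) = - (m.+1%:R - d%:R + k%:R) :> R by ring.
rewrite gbin_opp mulrA -exprMn mulrNN mulr1 expr1n mul1r.
have -> : m.+1%:R - d%:R + k%:R + d%:R - 1 = (m + k)%:R :> R.
  by rewrite -addn1 !natrD; ring.
rewrite gbin_nat /simplex_count; congr (_%:R).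
case: ifPn => km; last by rewrite bin_small //; lia.
by rewrite (_ : m.+1 - (d - k).+1 + d = m + k)%N //; lia.
Qed.

(** The share of one box point in the boundary count, as dilate minus interior. At [m = 0] it is the
    share in the lattice points of {0}, so that the total is the conventional value 1. *)
Definition bnd_count (m k : nat) : R :=
  if m == 0%N then (simplex_count 0 k)%:R
  else (simplex_count m k)%:R - (simplex_count m (d - k).+1)%:R.

(** After reciprocity the values at [m] and [- m] have weights [N - m] and [N + m]. These are
    absorbed into the binomial coefficient, which leaves [d] times a difference of order d - 1 of a
    polynomial of degree [d], hence an affine function of [k]. *)
Lemma functional_even N k : d = N.*2 -> (k <= d)%N ->
  \sum_(0 <= m < N.+1) (-1) ^+ (N + m) * 'C(2 * N, N + m)%:R *
     (d%:R * (simplex_count m k)%:R - (N + m)%:R * bnd_count m k)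
  = d%:R / 2 * (k%:R + k%:R - d%:R) :> R.
Proof.
move=> dN kd; have [M0|N0] := posnP N.
  by rewrite dN M0 big_nat_recl // big_geq // !mul0r subr0 mulr0 addr0.
have dNR : d%:R = N%:R + N%:R :> R by rewrite dN -addnn natrD.
have key : altsum d.-1 (fun j => gbin d ((- N%:R + (d%:R - k%:R)) + j%:R)) =
   k%:R - N%:R :> R.
  rewrite altsum_gbin ?leq_pred // (_ : d - d.-1 = 1)%N; last by lia.
  rewrite /gbin big_ord1 subr0 divr1 -signr_odd (_ : odd _ = true); last by lia.
  by rewrite expr1 dNR; ring.
(* The index is allowed to reach [d], where ['C(d.-1, d)] is 0, so that the range becomes symmetric
   about [N]. *)
pose H j : R := (-1) ^+ j * 'C(d.-1, j)%:R * gbin d (- N%:R + (d%:R - k%:R) + j%:R).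
have {}key : d%:R * (\sum_(j < N.*2.+1) H j) = d%:R / 2 * (k%:R + k%:R - d%:R).
  rewrite big_ord_recr /= {2}/H bin_small; last by lia.
  rewrite mulr0 mul0r addr0; transitivity (d%:R * (k%:R - N%:R) : R).
    by rewrite -key /altsum prednK -?dN //; lia.
  by rewrite dNR; field.
rewrite -{}key sum_fold big_ltn // [d%:R * (H N + _)]mulrDr; congr (_ + _).
  rewrite /H /bnd_count /= simplex_countE // addn0 mul2n -dN.
  rewrite (_ : - N%:R + _ + _ = 0%:R + (d%:R - k%:R)); last by ring.
  have : (d * 'C(d.-1, N) = N * 'C(d, N))%N by rewrite mul_bin_down; congr (_ * _)%N; lia.
  move=> /(congr1 (fun x => x%:R : R)); rewrite !natrM => e.
  transitivity ((-1) ^+ N * gbin d (0%:R + (d%:R - k%:R)) * (N%:R * 'C(d, N)%:R) : R).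
    by rewrite [X in X * _ - _]dNR; ring.
  by rewrite -e; ring.
rewrite mulr_sumr; apply: eq_big_nat => m /andP[m0 mN].
rewrite /H /bnd_count -(prednK m0); move: (m.-1) (prednK m0) => p pm.
rewrite /= simplex_countE // simplex_count_opp // mul2n -dN pm.
rewrite -(signr_odd _ d) dN odd_double -dN expr0 mul1r.
have e1 : (d * 'C(d.-1, N - m) = (N + m) * 'C(d, N + m))%N.
  rewrite -bin_sub; last by lia.
  rewrite (_ : d.-1 - _ = (N + m).-1)%N; last by lia.
  by rewrite mul_bin_diag prednK //; lia.
have e2 : (d * 'C(d.-1, N + m) = (N - m) * 'C(d, N + m))%N.
  by rewrite mul_bin_down; congr (_ * _)%N; lia.
move: e1 e2 => /(congr1 (fun x => x%:R : R)) + /(congr1 (fun x => x%:R : R)).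
rewrite !natrM natrB // => e1 e2.
rewrite (_ : - N%:R + _ + (N%:R - m%:R) = - m%:R + (d%:R - k%:R)); last by ring.
rewrite natrD (_ : - N%:R + _ + (N%:R + m%:R) = m%:R + (d%:R - k%:R)); last by ring.
have -> : (-1) ^+ (N - m) = (-1) ^+ (N + m) :> R.
  by rewrite -signr_odd -[RHS]signr_odd oddB // oddD.
set g1 := gbin _ _; set g2 := gbin _ _.
transitivity ((-1) ^+ (N + m) * ((d%:R * 'C(d.-1, N - m)%:R) * g2
                                 + (d%:R * 'C(d.-1, N + m)%:R) * g1) : R); last by ring.
by rewrite e1 e2 natrD dNR; ring.
Qed.

(** With j = N + m running over both signs of m, the weight is m d / 2 plus N^2 - m^2 = j (2N - j).
    In [key1] the factor m raises the degree to d + 1, matching the order of the difference; in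
    [key2] the factor j (2N - j) lowers the binomial coefficient from order d + 1 to d - 1. *)
Lemma functional_odd N k : d.+1 = N.*2 -> (k <= d)%N ->
  \sum_(0 <= m < N.+1) (-1) ^+ (N + m) * 'C(2 * N, N + m)%:R *
     (m%:R * d%:R * (simplex_count m k)%:R
      + (N%:R ^+ 2 - m%:R ^+ 2 - m%:R * d%:R / 2) * bnd_count m k)
  = d%:R * (d%:R + 1) / 2 * (k%:R + k%:R - d%:R) :> R.
Proof.
move=> dN kd; have N0 : (0 < N)%N by lia.
have dNR : d%:R = N%:R + N%:R - 1 :> R.
  by rewrite -natrD addnn -dN -natr1 addrK.
pose a x : R := gbin d (x + (d%:R - k%:R)).
pose H j : R := (-1) ^+ j * 'C(d.+1, j)%:R *
  (((j%:R - N%:R) * d%:R / 2 + j%:R * (N%:R + N%:R - j%:R)) * a (j%:R - N%:R)).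
have key1 : altsum d.+1 (fun j => (j%:R - N%:R) * a (j%:R - N%:R)) = d%:R + 1 :> R.
  (* The identity x C(x + d - k, d) = (d + 1) C(x + d - k, d + 1) + k C(x + d - k, d); the
     difference of order d + 1 kills the last term. *)
  rewrite (@eq_altsum _ _ _ (fun j => d.+1%:R * gbin d.+1 (- N%:R + (d%:R - k%:R) + j%:R)
      + k%:R * gbin d (- N%:R + (d%:R - k%:R) + j%:R))); last first.
    move=> j; rewrite gbinS /a (_ : j%:R - N%:R + _ = - N%:R + (d%:R - k%:R) + j%:R); last by ring.
    have h : d.+1%:R != 0 :> R by rewrite pnatr_eq0.
    by rewrite [d.+1%:R * _]mulrC divfK //; ring.
  transitivity (d.+1%:R * altsum d.+1 (fun j => gbin d.+1 (- N%:R + (d%:R - k%:R) + j%:R))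
      + k%:R * altsum d.+1 (fun j => gbin d (- N%:R + (d%:R - k%:R) + j%:R)) : R).
    by rewrite /altsum !mulr_sumr -big_split /=; apply: eq_bigr => i _; ring.
  rewrite altsum_gbin0 altsum_gbin // subnn dN -signr_odd odd_double /gbin big_ord0 -dN -natr1.
  by rewrite expr0 divr1; ring.
have key2 : \sum_(j < d.+2) (-1) ^+ j * 'C(d.+1, j)%:R *
   (j%:R * (N%:R + N%:R - j%:R) * a (j%:R - N%:R)) = - (d%:R + 1) * d%:R * (N%:R - k%:R).
  (* The two end terms drop out because j (2N - j) vanishes at j = 0 and at j = 2N. *)
  rewrite big_ord_recl big_ord_recr /= !mul0r mulr0 add0r.
  rewrite (_ : N%:R + N%:R - _ = 0); last first.
    by rewrite /bump /= add1n -natr1 dNR; ring.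
  rewrite mulr0 mul0r mulr0 addr0.
  have key : altsum d.-1 (fun j => gbin d ((1 - N%:R + (d%:R - k%:R)) + j%:R)) = N%:R - k%:R :> R.
    rewrite altsum_gbin ?leq_pred // (_ : d - d.-1 = 1)%N; last by lia.
    rewrite /gbin big_ord1 subr0 divr1 -signr_odd (_ : odd _ = false); last by lia.
    by rewrite expr0 dNR; ring.
  rewrite -{}key /altsum prednK; last by lia.
  rewrite mulr_sumr; apply: eq_bigr => i _.
  have e : (d.+1 * (d * 'C(d.-1, i)) = 'C(d.+1, i.+1) * i.+1 * (d - i))%N.
    by rewrite mul_bin_down mulnCA (mul_bin_diag d.+1 i) mulnC [(i.+1 * _)%N]mulnC.
  rewrite /bump /= add1n /a.
  rewrite (_ : i.+1%:R - N%:R + _ = 1 - N%:R + (d%:R - k%:R) + i%:R); last by rewrite -natr1; ring.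
  set g := gbin _ _.
  transitivity (- ((-1) ^+ i * g * ('C(d.+1, i.+1) * i.+1 * (d - i))%:R) : R).
    by rewrite !natrM natrB ?(ltnW (ltn_ord i)) // exprS dNR -natr1; ring.
  by rewrite -e !natrM -natr1; ring.
have {key1 key2} key : \sum_(j < N.*2.+1) H j = d%:R * (d%:R + 1) / 2 * (k%:R + k%:R - d%:R) :> R.
  transitivity (d%:R / 2 * (d%:R + 1) + - (d%:R + 1) * d%:R * (N%:R - k%:R) : R).
    rewrite -{}key2 -key1 -dN /altsum mulr_sumr -big_split /=; apply: eq_bigr => i _.
    by rewrite /H; ring.
  by rewrite dNR; field.
rewrite -{}key sum_fold big_ltn //; congr (_ + _).
  rewrite /H /bnd_count /= simplex_countE // addn0 mul2n -dN.
  by rewrite /a subrr; ring.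
apply: eq_big_nat => m /andP[m0 mN].
rewrite /H /bnd_count -(prednK m0); move: (m.-1) (prednK m0) => p pm.
rewrite /= simplex_countE // simplex_count_opp // mul2n -dN pm.
rewrite -(signr_odd _ d) (_ : odd d); last by lia.
rewrite expr1 natrB // natrD /a.
have -> : (-1) ^+ (N - m) = (-1) ^+ (N + m) :> R.
  by rewrite -signr_odd -[RHS]signr_odd oddB // oddD.
have -> : 'C(d.+1, N - m) = 'C(d.+1, N + m).
  by rewrite -bin_sub; [congr 'C(_, _); lia | lia].
rewrite (_ : N%:R - m%:R - N%:R = - m%:R); last by ring.
rewrite (_ : N%:R + m%:R - N%:R = m%:R); last by ring.
by field.
Qed.

End Functional.

(** * A regular complete fan on the generators *)

Section Fan.
Variables (R : realType) (d n : nat) (W : 'M[R]_(n, d)).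
Implicit Types (S : {set 'I_n}) (x y z : 'rV[R]_d) (c : 'cV[R]_n) (l : 'rV[R]_n).

Definition restr S m (A : 'M[R]_(n, m)) : 'M[R]_(#|S|, m) :=
  rowsub (@enum_val _ (mem S)) A.

Definition gens S := restr S W.

Definition is_basis S := row_free (gens S) && row_full (gens S).

(** The pseudo-inverse makes this total in [S]; it is a true inverse only when [S] is a basis. *)
Definition coords S z : 'rV[R]_#|S| := z *m pinvmx (gens S).

(* The value at [z] of the linear form equal to [c j] at each [row j W] with [j] in [S]. *)
Definition form S c z : R := (coords S z *m restr S c) 0 0.

Definition supp l : {set 'I_n} := [set j | l 0 j != 0].

(* [mxE] would also unfold the matrix products hidden in the operands. *)
Lemma mxDE p q (A B : 'M[R]_(p, q)) i j : (A + B) i j = A i j + B i j.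
Proof. by rewrite mxE. Qed.

Lemma mxNE p q (A : 'M[R]_(p, q)) i j : (- A) i j = - A i j.
Proof. by rewrite mxE. Qed.

Lemma mxZE p q a (A : 'M[R]_(p, q)) i j : (a *: A) i j = a * A i j.
Proof. by rewrite mxE. Qed.

Lemma restrE S m (A : 'M[R]_(n, m)) i j : restr S A i j = A (enum_val i) j.
Proof. by rewrite mxE. Qed.

Lemma enum_val_ex S j : j \in S -> exists i : 'I_#|S|, j = enum_val i.
Proof. by move=> jS; exists (enum_rank_in jS j); rewrite enum_rankK_in. Qed.

(** Right multiplication by [restr S 1%:M] extends a row indexed by [S] by zeros to all
    generators. *)
Lemma restr_mul S (v : 'rV_#|S|) m (A : 'M[R]_(n, m)) :
  v *m restr S 1%:M *m A = v *m restr S A.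
Proof. by rewrite -mulmxA -rowsubE. Qed.

Lemma extE S (v : 'rV_#|S|) j :
  (v *m restr S 1%:M) 0 j = \sum_i v 0 i * (enum_val i == j)%:R.
Proof. by rewrite mxE; apply: eq_bigr => i _; rewrite !mxE. Qed.

Lemma ext_enum_val S (v : 'rV_#|S|) i : (v *m restr S 1%:M) 0 (enum_val i) = v 0 i.
Proof.
rewrite extE (bigD1 i) //= eqxx mulr1 big1 ?addr0 // => k ki.
by rewrite (inj_eq enum_val_inj) (negbTE ki) mulr0.
Qed.

Lemma ext_notin S (v : 'rV_#|S|) j : j \notin S -> (v *m restr S 1%:M) 0 j = 0.
Proof.
move=> jS; rewrite extE big1 // => i _; case: eqP => [e|]; last by rewrite mulr0.
by rewrite -e enum_valP in jS.
Qed.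

Lemma supp_ext l : colsub (@enum_val _ (mem (supp l))) l *m restr (supp l) 1%:M = l.
Proof.
apply/rowP => j; have [jS|jS] := boolP (j \in supp l).
  by rewrite -(enum_rankK_in jS jS) ext_enum_val mxE.
by rewrite ext_notin //; move: jS; rewrite inE negbK => /eqP.
Qed.

Lemma coordsK S z : is_basis S -> coords S z *m gens S = z.
Proof. by move=> /andP[_ fS]; rewrite mulmxKpV // submx_full. Qed.

Lemma coords_mul S (t : 'rV_#|S|) : is_basis S -> coords S (t *m gens S) = t.
Proof. by move=> /andP[fS _]; rewrite /coords mulmxKp. Qed.

Lemma card_basis S : is_basis S -> #|S| = d.
Proof. by move=> /andP[/eqP r1 /eqP r2]; exact: etrans (esym r1) r2. Qed.

Lemma coordsD S x y : coords S (x + y) = coords S x + coords S y.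
Proof. by rewrite /coords mulmxDl. Qed.

Lemma coordsZ S a x : coords S (a *: x) = a *: coords S x.
Proof. by rewrite /coords scalemxAl. Qed.

(* While the support of [l] is dependent, move along a relation of nonpositive
   cost until a coefficient vanishes; positivity of [c] guarantees a negative entry. *)
Lemma caratheodory c l : (forall j, 0 < c j 0) -> (forall j, 0 <= l 0 j) ->
  exists S (t : 'rV_#|S|), [/\ row_free (gens S), forall i, 0 < t 0 i,
    t *m gens S = l *m W & (t *m restr S c) 0 0 <= (l *m c) 0 0].
Proof.
move=> c0; have [k] := ubnP #|supp l|; elim: k l => // k IH l lk l0.
have [fS|] := boolP (row_free (gens (supp l))).
  exists (supp l), (colsub enum_val l); split => //.
  - move=> i; rewrite mxE lt_neqAle l0 andbT eq_sym.
    by have := enum_valP i; rewrite inE.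
  - by rewrite -restr_mul supp_ext.
  - by rewrite -restr_mul supp_ext.
rewrite -kermx_eq0 => /rowV0Pn[v /sub_kermxP vW v0].
pose mu := v *m restr (supp l) 1%:M.
have muW : mu *m W = 0 by rewrite /mu restr_mul.
have mu_supp j : l 0 j = 0 -> mu 0 j = 0.
  by move=> lj; apply: ext_notin; rewrite inE lj eqxx.
have mu0 : mu != 0.
  apply: contraNneq v0 => mu0; apply/eqP/rowP => i.
  by rewrite -ext_enum_val -/mu mu0 !mxE.
clearbody mu; clear v vW v0.
have {muW mu_supp mu0 mu}[mu [muW mu_supp mu0 muc]] : exists mu' : 'rV_n, [/\ mu' *m W = 0,
  (forall j, l 0 j = 0 -> mu' 0 j = 0), mu' != 0 & (mu' *m c) 0 0 <= 0].
  have [h|h] := leP ((mu *m c) 0 0) 0; first by exists mu.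
  exists (- mu); split; rewrite ?mulNmx ?muW ?oppr0 ?oppr_eq0 //.
    by move=> j lj; rewrite mxE mu_supp // oppr0.
  by rewrite mxE oppr_le0 ltW.
have [j0 j0N] : exists j, mu 0 j < 0.
  apply/existsP; apply: contraNT mu0; rewrite negb_exists => /forallP muP.
  have {}muP j : 0 <= mu 0 j by rewrite leNgt.
  have : (mu *m c) 0 0 == 0.
    by rewrite eq_le muc mxE sumr_ge0 // => j _; rewrite mulr_ge0 // ltW.
  rewrite mxE psumr_eq0 => [/allP h|j _]; last by rewrite mulr_ge0 // ltW.
  apply/eqP/rowP => j; have := h j (mem_index_enum _).
  by rewrite mulf_eq0 (gt_eqF (c0 j)) orbF !mxE => /eqP.
(* Ratio test: the least quotient is the longest step along [mu] that keeps all coefficients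
   nonnegative, and the coefficient at the minimizer becomes 0. *)
have [j jN jmin] := @arg_minP _ R _ j0 (fun j => mu 0 j < 0) (fun j => l 0 j / - mu 0 j) j0N.
pose t := l 0 j / - mu 0 j.
have t0 : 0 <= t by rewrite divr_ge0 // oppr_ge0 ltW.
pose l' := l + t *: mu.
have l'0 i : 0 <= l' 0 i.
  rewrite !mxE; have [h|h] := leP 0 (mu 0 i); first by rewrite addr_ge0 // mulr_ge0.
  by have := jmin i h; rewrite -/t ler_pdivlMr ?oppr_gt0 // mulrN -subr_ge0 opprK.
have l'W : l' *m W = l *m W by rewrite mulmxDl -scalemxAl muW scaler0 addr0.
have l'c : (l' *m c) 0 0 <= (l *m c) 0 0.
  rewrite mulmxDl -scalemxAl mxE [X in _ + X]mxE gerDl.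
  by rewrite mulr_ge0_le0.
have l'k : (#|supp l'| < k)%N.
  rewrite -ltnS; apply: leq_trans lk; rewrite ltnS; apply/proper_card/properP; split.
    apply/fintype.subsetP => i; rewrite !inE; apply: contraNneq => li.
    by rewrite !mxE li mu_supp // mulr0 addr0.
  exists j; rewrite !inE; first by apply: contraTneq jN => /mu_supp ->; rewrite ltxx.
  by rewrite negbK !mxE /t invrN mulrN mulNr divfK ?subrr // lt_eqF.
have [S [v [h1 h2 h3 h4]]] := IH l' l'k l'0.
by exists S, v; split; rewrite // ?h3 // (le_trans h4).
Qed.

(** A nonzero polynomial has finitely many roots; they are split off one at a time. *)
Lemma near0_horner_neq0 (q : {poly R}) : q != 0 -> \forall e \near 0^'+, q.[e] != 0.
Proof.
have [k] := ubnP (size q); elim: k q => // k IH q qk q0.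
have [[a qa]|noroot] := pselect (exists a, root q a); last first.
  by near=> e; apply/negP => qe; apply: noroot; exists e.
have /factor_theorem[p qE] := qa.
have p0 : p != 0 by apply: contraNneq q0 => p0; rewrite qE p0 mul0r.
have pk : (size p < k)%N.
  by move: qk; rewrite qE size_Mmonic ?monicXsubC // size_XsubC addn2 /=.
have := IH p pk p0 => {}IH.
have ha : \forall e \near 0^'+, e != a.
  have [a0|a0] := leP a 0; first by near=> e; rewrite gt_eqF // (le_lt_trans a0).
  by near=> e; rewrite lt_eqF.
by near=> e; rewrite qE hornerM mulf_neq0 //; [near: e | rewrite hornerXsubC subr_eq0; near: e].
Unshelve. all: by end_near.
Qed.

Lemma near0_horner_gt0 (q : {poly R}) : 0 < q.[0] -> \forall e \near 0^'+, 0 < q.[e].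
Proof.
move=> q0; apply: (@cvgr_gt R R _ _ (horner q)) q0.
by apply: cvg_at_right_filter; exact: continuous_horner.
Qed.

(* The first clause says that [z] avoids the span of every family of
   generators of rank less than [d]. *)
Definition generic z : Prop :=
  (forall S j, col j (cokermx (gens S)) != 0 -> (z *m cokermx (gens S)) 0 j != 0) /\
  (forall S i, is_basis S -> coords S z 0 i != 0).

Lemma genericN z : generic z -> generic (- z).
Proof.
case=> h1 h2; split=> [S j /h1|S i /h2-/(_ i)]; first by rewrite mulNmx [X in _ -> X != 0]mxE oppr_eq0.
by rewrite /coords mulNmx [X in _ -> X != 0]mxE oppr_eq0.
Qed.

Lemma near0_affine_neq0 (a b : R) : b != 0 -> \forall e \near 0^'+, a + e * b != 0.
Proof.
move=> b0; have : a%:P + b *: 'X != 0.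
  apply: contraNneq b0 => /(congr1 (fun p : {poly R} => p`_1)).
  by rewrite coefD coefC coefZ coefX /= mulr1 add0r coef0 => ->.
move=> /near0_horner_neq0; apply: filterS => e.
by rewrite !hornerE mulrC.
Qed.

(** Each of the finitely many conditions is affine in [e] with a slope that is nonzero because [y]
    is generic. *)
Lemma near0_generic x y : generic y -> \forall e \near 0^'+, generic (x + e *: y).
Proof.
case=> h1 h2; have g1 : \forall e \near 0^'+, forall S j,
    col j (cokermx (gens S)) != 0 -> ((x + e *: y) *m cokermx (gens S)) 0 j != 0.
  apply: filter_forall => S; apply: filter_forall => j.
  have [_|/h1 yj] := eqVneq (col j (cokermx (gens S))) 0; first by near=> e.
  apply: filterS (near0_affine_neq0 ((x *m cokermx (gens S)) 0 j) yj) => e + _.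
  by rewrite mulmxDl -scalemxAl !mxE.
have g2 : \forall e \near 0^'+, forall S i, is_basis S -> coords S (x + e *: y) 0 i != 0.
  apply: filter_forall => S; apply: filter_forall => i.
  have [bS|_] := boolP (is_basis S); last by near=> e.
  apply: filterS (near0_affine_neq0 (coords S x 0 i) (h2 S i bS)) => e + _.
  by rewrite coordsD coordsZ !mxE.
by near=> e; split; near: e.
Unshelve. all: by end_near.
Qed.

(** On the moment curve (1, e, e^2, ...) a linear form becomes the polynomial with the same
    coefficients; hence a nonzero form vanishes at finitely many points of the curve only. *)
Lemma moment_poly (v : 'cV[R]_d) (e : R) :
  ((\row_j e ^+ j) *m v) 0 0 = (\poly_(j < d) (if insub j is Some k then v k 0 else 0)).[e].
Proof.
rewrite mxE horner_poly; apply: eq_bigr => i _.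
by rewrite mxE insubT // => h; rewrite mulrC; congr (v _ 0 * _); exact: val_inj.
Qed.

Lemma near0_moment (v : 'cV[R]_d) : v != 0 ->
  \forall e \near 0^'+, ((\row_j e ^+ j) *m v) 0 0 != 0.
Proof.
move=> v0; under eq_near do rewrite moment_poly.
apply: near0_horner_neq0; apply: contraNneq v0 => /polyP p0.
apply/eqP/colP => j; have := p0 j.
rewrite coef_poly ltn_ord insubT // => h; rewrite coef0 => e0.
by rewrite [RHS]mxE -e0; congr (v _ 0); exact: val_inj.
Qed.

Lemma exists_generic : exists y, generic y.
Proof.
suff : \forall e \near 0^'+, generic (\row_j e ^+ j) by case/filter_ex => e; exists (\row_j e ^+ j).
have g1 : \forall e \near 0^'+, forall S j,
    col j (cokermx (gens S)) != 0 -> ((\row_j e ^+ j) *m cokermx (gens S)) 0 j != 0.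
  apply: filter_forall => S; apply: filter_forall => j.
  have [_|v0] := eqVneq (col j (cokermx (gens S))) 0; first by near=> e.
  by apply: filterS (near0_moment v0) => e + _; rewrite colE mulmxA -colE mxE.
have g2 : \forall e \near 0^'+, forall S i, is_basis S -> coords S (\row_j e ^+ j) 0 i != 0.
  apply: filter_forall => S; apply: filter_forall => i.
  have [bS|_] := boolP (is_basis S); last by near=> e.
  have v0 : col i (pinvmx (gens S)) != 0.
    have /andP[fS _] := bS.
    apply/eqP => ci; have := mulmxVp fS => /(congr1 (col i)); rewrite [LHS]colE -mulmxA -colE ci mulmx0.
    by move=> /colP/(_ i); rewrite !mxE eqxx => /eqP; rewrite eq_sym oner_eq0.
  by apply: filterS (near0_moment v0) => e + _; rewrite colE mulmxA -colE mxE.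
by near=> e; split; near: e.
Unshelve. all: by end_near.
Qed.

(** If the rank were below [d], some nonzero column of the cokernel would annihilate [z], against
    genericity. *)
Lemma generic_basis z S (t : 'rV_#|S|) :
  generic z -> row_free (gens S) -> t *m gens S = z -> is_basis S.
Proof.
case=> h1 _ fS tz; rewrite /is_basis fS /= /row_full eqn_leq rank_leq_col /= leqNgt.
apply/negP => rS; have : cokermx (gens S) != 0.
  by rewrite -mxrank_eq0 mxrank_coker subn_eq0 -ltnNge.
case/eqP; apply/matrixP => i j; have [/colP/(_ i)|/h1] := eqVneq (col j (cokermx (gens S))) 0.
  by rewrite !mxE.
by rewrite -tz -mulmxA mulmx_coker mulmx0 mxE eqxx.
Qed.

Definition height S z : R := \sum_i coords S z 0 i.

(** [c] lifts the generators. The first condition on bases says that the lifting is generic, so that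
    the induced fan is simplicial; the second says that it refines the constant lifting 1, so that
    the fan subdivides the cones over the facets. *)
Definition weight_ok c := (forall j, 0 < c j 0) /\
  forall S j, is_basis S -> j \notin S ->
    form S c (row j W) != c j 0 /\
    (form S c (row j W) < c j 0 -> height S (row j W) <= 1).

(* Take [c_j = 1 + e^(j+1)] with small [e > 0]: the comparisons with [c_j] are
   then governed by nonzero polynomials in [e], whose value at [0] compares the
   height with [1]. *)
Lemma exists_weight : exists c, weight_ok c.
Proof.
pose c e : 'cV[R]_n := \col_j (1 + e ^+ j.+1).
suff : \forall e \near 0^'+, weight_ok (c e) by case/filter_ex => e; exists (c e).
have h : \forall e \near 0^'+, forall S j, is_basis S -> j \notin S ->
    form S (c e) (row j W) != c e j 0 /\
    (form S (c e) (row j W) < c e j 0 -> height S (row j W) <= 1).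
  apply: filter_forall => S; apply: filter_forall => j.
  have [jS|jS] := boolP (j \in S); first by near=> e.
  have [a aE] : exists a, a = coords S (row j W) by exists (coords S (row j W)).
  pose q := \sum_i a 0 i *: (1 + 'X^((enum_val i : nat).+1)) - 1 - 'X^(j.+1) : {poly R}.
  have qE e : q.[e] = form S (c e) (row j W) - c e j 0.
    rewrite /q !hornerE horner_sum /form -aE !mxE opprD addrA.
    by congr (_ - _ - _); apply: eq_bigr => i _; rewrite !hornerE !mxE.
  (* Since [j] is not in [S], no other monomial meets degree j + 1, where the coefficient is -1. *)
  have q0 : q != 0.
    apply/eqP => /polyP/(_ j.+1); rewrite !coefB coef_sum coef1 coefXn eqxx subr0 coef0 /=.
    rewrite big1 => [/eqP|i _]; first by rewrite sub0r oppr_eq0 oner_eq0.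
    rewrite coefZ coefD coef1 coefXn eqSS add0r; case: eqP => [e|]; last by rewrite mulr0.
    by move: jS; rewrite (val_inj e) enum_valP.
  have nq := near0_horner_neq0 q0.
  rewrite /height -aE; have [h|h] := leP (\sum_i a 0 i) 1.
    by apply: filterS nq => e; rewrite qE subr_eq0.
  have : 0 < q.[0].
    rewrite /q !hornerE horner_sum expr0n /= subr0 subr_gt0.
    apply: (lt_le_trans h); rewrite le_eqVlt; apply/orP; left; apply/eqP.
    by apply: eq_bigr => i _; rewrite !hornerE ?expr0n /= ?addr0 ?mulr1.
  move/near0_horner_gt0 => pq; near=> e.
  move=> _ _; have qe : 0 < q.[e] by near: e.
  move: qe; rewrite qE subr_gt0 => qe; rewrite gt_eqF //; split => // /(lt_trans qe).
  by rewrite ltxx.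
near=> e; split; last by near: e.
by move=> j; rewrite mxE ltr_wpDr // exprn_ge0 // ltW.
Unshelve. all: by end_near.
Qed.

(** The maximal cones of the regular triangulation induced by [c], that is, the lower facets of the
    cone over the lifted generators. *)
Definition triangulation c : {set {set 'I_n}} :=
  [set S | is_basis S && [forall j, (j \notin S) ==> (form S c (row j W) < c j 0)]].

Definition open_cone S z := [forall i, 0 < coords S z 0 i].

Lemma form_comb S S' c (t : 'rV_#|S'|) :
  form S c (t *m gens S') = \sum_i t 0 i * form S c (row (enum_val i) W).
Proof.
have [p formE] : exists p : 'cV_d, forall z, form S c z = (z *m p) 0 0.
  by exists (pinvmx (gens S) *m restr S c) => z; rewrite /form /coords -mulmxA.
rewrite formE -mulmxA mxE; apply: eq_bigr => i _.
by rewrite formE /gens /restr mul_rowsub_mx -row_mul !mxE.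
Qed.

Lemma form_gen S c j : is_basis S -> j \in S -> form S c (row j W) = c j 0.
Proof.
move=> bS jS; rewrite -(enum_rankK_in jS jS) -row_rowsub -/(restr S W) -/(gens S).
by rewrite rowE /form coords_mul // -rowE !mxE.
Qed.

(** Expanding [z] with positive coordinates in one cone shows that the form of the other cone is at
    most as large at [z], with equality exactly under inclusion of generators. The argument is
    symmetric. *)
Lemma triangulation_uniq c z S S' :
  S \in triangulation c -> S' \in triangulation c ->
  open_cone S z -> open_cone S' z -> S = S'.
Proof.
have key A B : A \in triangulation c -> B \in triangulation c ->
    open_cone A z -> form B c z <= form A c z ?= iff (A \subset B).
  rewrite !inE => /andP[bA _] /andP[bB /forallP hB] /forallP zA.
  rewrite -{1}(coordsK z bA) form_comb {2}/form mxE.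
  have -> : (A \subset B) = [forall (i : 'I_#|A| | true), enum_val i \in B].
    apply/fintype.subsetP/forallP => [h i|h j jA]; first by rewrite h ?enum_valP.
    by have := h (enum_rank_in jA j); rewrite enum_rankK_in.
  apply: leif_sum => i _; rewrite restrE; apply/leifP.
  have [iB|iB] := boolP (enum_val i \in B); first by rewrite form_gen.
  by rewrite ltr_pM2l ?zA //; have := hB (enum_val i); rewrite iB.
move=> SS SS' zS zS'; have h1 := key _ _ SS SS' zS; have h2 := key _ _ SS' SS zS'.
apply/eqP; rewrite finset.eqEsubset -(ge_leif h1) -(ge_leif h2).
by rewrite h1 h2.
Qed.

(** A simplex-method argument: among the bases whose open cone contains [z], one of least cost is in
    the triangulation. A violating generator would give a cheaper representation of [z], which
    Caratheodory turns into a cheaper basis. *)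
Lemma triangulation_exists c z l : weight_ok c -> generic z ->
  (forall j, 0 <= l 0 j) -> l *m W = z ->
  exists2 S, S \in triangulation c & open_cone S z.
Proof.
move=> [c0 cgen] gz l0 lz.
have improve l' : (forall j, 0 <= l' 0 j) -> l' *m W = z ->
    exists2 S, is_basis S && open_cone S z & form S c z <= (l' *m c) 0 0.
  move=> l'0 l'z; have [S [t [fS t0 tz tc]]] := caratheodory c0 l'0.
  rewrite l'z in tz; have bS := generic_basis gz fS tz.
  have tE : coords S z = t by rewrite -tz coords_mul.
  by exists S; [rewrite bS; apply/forallP => i | rewrite /form]; rewrite tE.
have [S0 hS0 _] := improve l l0 lz.
have [S /andP[bS zS] Smin] := @arg_minP _ R _ S0
  (fun S => is_basis S && open_cone S z) (fun S => form S c z) hS0.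
exists S => //; rewrite inE bS /=; apply/forallP => j; apply/implyP => jS.
have [ne _] := cgen S j bS jS; rewrite lt_neqAle ne /= leNgt; apply/negP => lt_c.
(* The pivot direction: one unit of the generator [j] traded against its expansion in [S]. It can be
   negative only on [S], where the coordinates of [z] are positive, so a short step is
   admissible. *)
pose mu := delta_mx 0 j - coords S (row j W) *m restr S 1%:M.
have muW : mu *m W = 0 by rewrite mulmxBl -rowE restr_mul -/(gens S) coordsK // subrr.
have muc : (mu *m c) 0 0 < 0.
  by rewrite mulmxBl -rowE restr_mul mxDE mxNE -/(form S c _) mxE subr_lt0.
have mu0 i : i \notin S -> 0 <= mu 0 i by move=> iS; rewrite mxDE mxNE ext_notin // subr0 mxE.
clearbody mu.
have zpos : \forall e \near 0^'+, forall i, 0 <= (coords S z *m restr S 1%:M + e *: mu) 0 i.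
  apply: filter_forall => i; have [iS|iS] := boolP (i \in S); last first.
    near=> e; rewrite mxDE ext_notin // add0r mxZE mulr_ge0 ?mu0 // ltW //.
  have cp : 0 < (coords S z *m restr S 1%:M) 0 i.
    by have [k ->] := enum_val_ex iS; rewrite ext_enum_val; have /forallP := zS; exact.
  have : 0 < (((coords S z *m restr S 1%:M) 0 i)%:P + mu 0 i *: 'X).[0] by rewrite !hornerE.
  move/near0_horner_gt0; apply: filterS => e /ltW.
  by rewrite !hornerE mxDE mxZE mulrC.
have /filter_ex[e [e0 epos]] : \forall e \near 0^'+, 0 < e /\
   forall i, 0 <= (coords S z *m restr S 1%:M + e *: mu) 0 i.
  by near=> e; split => //; near: e.
have [|S' hS' lec] := improve _ epos.
  by rewrite mulmxDl -scalemxAl muW scaler0 addr0 restr_mul -/(gens S) coordsK.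
have := le_trans (Smin S' hS') lec.
rewrite mulmxDl restr_mul -scalemxAl [X in _ <= X]mxDE [X in _ + X]mxZE -/(form S c z) lerDl leNgt.
by rewrite pmulr_rlt0 // muc.
Unshelve. all: by end_near.
Qed.

End Fan.

(** * Counting lattice points in half-open cones *)

Section BoundedTuples.

(** Entries are drawn from an ordinal to have finitely many tuples; a sum of at most [m - k] bounds
    every entry in this way. *)
Definition bounded_tuples (r m k : nat) : seq (r.-tuple nat) :=
  if (k <= m)%N then
    [seq map_tuple (fun i : 'I_(m - k).+1 => i : nat) t
    | t <- enum [set t : r.-tuple 'I_(m - k).+1 | (\sum_(i <- t) i <= m - k)%N]%SET]
  else [::].

Lemma size_bounded_tuples r m k : size (bounded_tuples r m k) = simplex_count r m k.
Proof.
rewrite /bounded_tuples /simplex_count; case: ifP => // km.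
by rewrite size_map -cardE card_partial_ord_partitions addnC.
Qed.

Lemma uniq_bounded_tuples r m k : uniq (bounded_tuples r m k).
Proof.
rewrite /bounded_tuples; case: ifP => // km.
rewrite map_inj_uniq ?enum_uniq // => t t' /(congr1 val) /= /inj_map tt'.
by apply: val_inj; apply: tt'; exact: val_inj.
Qed.

Lemma mem_bounded_tuples r m k (t : r.-tuple nat) :
  (t \in bounded_tuples r m k) = (\sum_(i <- t) i + k <= m)%N.
Proof.
rewrite /bounded_tuples; case: ifPn => [km|]; last first.
  by rewrite -ltnNge => mk; rewrite leqNgt (leq_trans mk) // leq_addl.
apply/mapP/idP => [[u]|h].
  by rewrite mem_enum inE => hu ->; rewrite /= big_map -[leqRHS](subnK km) leq_add2r.
have h' : (\sum_(i <- t) i <= m - k)%N by rewrite -(leq_add2r k) subnK.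
have le_t i : i \in val t -> (i < (m - k).+1)%N.
  move=> it; rewrite ltnS (leq_trans _ h') //.
  by rewrite (big_rem i it) /= leq_addr.
pose u := [tuple of map (fun i => inord i : 'I_(m - k).+1) t].
have tu : t = map_tuple (fun i : 'I_(m - k).+1 => i : nat) u.
  apply: val_inj; rewrite /= -map_comp map_id_in // => i it /=.
  by rewrite inordK // le_t.
exists u => //; rewrite mem_enum inE.
by move: h'; rewrite tu /= big_map.
Qed.

End BoundedTuples.

Lemma card_fset_setE (K : choiceType) (A : set K) (s : seq K) :
  uniq s -> (forall x, A x <-> x \in s) -> finite_set A /\ #|` fset_set A| = size s.
Proof.
move=> us As; have fA : finite_set A.
  by have -> : A = [set` s]; [apply/seteqP; split => x /As | exact: finite_seq].
split=> //; apply/perm_size/uniq_perm => // x; rewrite in_fset_set //.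
by apply/idP/idP => [/set_mem/As|/As/mem_set].
Qed.

Lemma card_fset_set_partition (K : choiceType) (I : finType) (T : {set I})
    (A : set K) (B : I -> set K) :
  (forall x, A x -> exists2 i, i \in T & B i x) ->
  (forall x i j, A x -> i \in T -> j \in T -> B i x -> B j x -> i = j) ->
  (forall i, i \in T -> finite_set (A `&` B i)) ->
  finite_set A /\ #|` fset_set A| = (\sum_(i in T) #|` fset_set (A `&` B i)|)%N.
Proof.
move=> exB uB finB; have fA : finite_set A.
  apply: (@sub_finite_set _ _ (\bigcup_(i in [set i | i \in T]) (A `&` B i))).
    by move=> x Ax; have [i iT Bx] := exB x Ax; exists i.
  by apply: bigcup_finite => //; exact: finite_finset.
split=> //; transitivity (\sum_(i in T) \sum_(x <- fset_set A) `[<B i x>])%N.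
  rewrite exchange_big /= -[LHS]sum1_size [LHS]big_seq [RHS]big_seq.
  apply: eq_bigr => x; rewrite in_fset_set // => /set_mem Ax.
  have [i iT Bx] := exB x Ax; rewrite (bigD1 i) //= asboolT // big1 // => j /andP[jT ji].
  by rewrite asboolF // => Bj; rewrite (uB x i j) // eqxx in ji.
apply: eq_bigr => i iT.
have [||_ ->] := @card_fset_setE _ (A `&` B i) [seq x <- fset_set A | `[<B i x>]].
- by rewrite filter_uniq.
- move=> x; rewrite mem_filter in_fset_set //; split=> [[Ax Bx]|/andP[/asboolP ? /set_mem ?]] //.
  by rewrite mem_set // andbT; apply/asboolP.
by rewrite size_filter -sum1_count [RHS]big_mkcond /=; apply: eq_bigr => x _; case: asboolP.
Qed.

Section UnitInterval.
Variable R : realType.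
Implicit Types (a b : R) (k : int).

(* [b] records on which side the half-open unit interval is closed. *)
Definition unit_itv b a := if 0 < b then 0 <= a < 1 else 0 < a <= 1.

Lemma unit_itv_ge0 b a : unit_itv b a -> 0 <= a.
Proof. by rewrite /unit_itv; case: ifP => _ /andP[] // /ltW. Qed.

Lemma unit_itv_le1 b a : unit_itv b a -> a <= 1.
Proof. by rewrite /unit_itv; case: ifP => _ /andP[] // _ /ltW. Qed.

Lemma unit_itv_opp b a : b != 0 -> unit_itv (- b) (1 - a) = unit_itv b a.
Proof.
move=> b0; rewrite /unit_itv oppr_gt0; have [b1|b1|b1] := ltgtP b 0; last by rewrite b1 eqxx in b0.
  by rewrite subr_ge0 ltrBlDl ltrDr andbC.
by rewrite subr_gt0 gerBl andbC.
Qed.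

Lemma unit_itv_int_part b a : exists k, unit_itv b (a - k%:~R).
Proof.
rewrite /unit_itv; case: (0 < b).
  by exists (Num.floor a); rewrite subr_ge0 floor_le /= ltrBlDl -[1]/(1%:~R) -intrD floorD1_gt.
exists (Num.ceil a - 1); have /andP[h1 h2] := ceil_itv a.
by rewrite subr_gt0 h1 /= lerBlDl intrD addrNK.
Qed.

Lemma unit_itv_inj b a k : unit_itv b a -> unit_itv b (a + k%:~R) -> k = 0.
Proof.
move=> h1 h2; have : -1 < (k%:~R : R) < 1.
  move: h1 h2; rewrite /unit_itv; case: ifP => _ /andP[? ?] /andP[? ?]; apply/andP; split; lra.
by rewrite -[-1]/((-1)%:~R) -[1]/(1%:~R) !ltr_int; lia.
Qed.

(** The closed end of the unit interval is chosen to agree with the half-open cone, so that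
    membership of a translated box point depends on the integer part alone. *)
Lemma half_open_int b a k : unit_itv b a ->
  (0 < a + k%:~R) || ((a + k%:~R == 0) && (0 < b)) = (0 <= k).
Proof.
rewrite /unit_itv => h; apply/orP/idP => [h'|k0].
  suff : -1 < k%:~R :> R by rewrite -[-1]/((-1)%:~R) ltr_int; lia.
  case: h'; first by move: h; case: ifP => _ /andP[? ?] ?; lra.
  by case/andP => /eqP e b0; move: h; rewrite b0 => /andP[? ?]; lra.
have k0' : 0 <= k%:~R :> R by rewrite ler0z.
case: ifP h => b0 /andP[h1 h2]; last by left; lra.
by rewrite andbT eq_sym; apply/orP; rewrite orbC -le_eqVlt; lra.
Qed.

End UnitInterval.

Section HalfOpenCones.
Variables (R : realType) (d n : nat) (W : 'M[R]_(n, d)).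
Implicit Types (S : {set 'I_n}) (x y z p : 'rV[R]_d) (c : 'cV[R]_n).

(** Coordinatewise form of the condition that [x + e *: y] lies in the open cone for all small
    [e > 0]. *)
Definition half_open y S x :=
  [forall i, (0 < coords W S x 0 i) || ((coords W S x 0 i == 0) && (0 < coords W S y 0 i))].

Lemma half_openP y S x : reflect
  (forall i, (0 < coords W S x 0 i) || ((coords W S x 0 i == 0) && (0 < coords W S y 0 i)))
  (half_open y S x).
Proof. exact: forallP. Qed.

Lemma half_open_coord_ge0 y S x i : half_open y S x -> 0 <= coords W S x 0 i.
Proof. by move=> /half_openP/(_ i)/orP[/ltW//|/andP[/eqP ->]]. Qed.

Lemma half_open_near y x : \forall e \near 0^'+, forall S,
  half_open y S x = open_cone W S (x + e *: y).
Proof.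
apply: filter_forall => S.
have h : \forall e \near 0^'+, forall i, (0 < coords W S (x + e *: y) 0 i) =
    (0 < coords W S x 0 i) || ((coords W S x 0 i == 0) && (0 < coords W S y 0 i)).
  apply: filter_forall => i; pose a := coords W S x 0 i; pose b := coords W S y 0 i.
  have E e : coords W S (x + e *: y) 0 i = (a%:P + b *: 'X).[e].
    by rewrite coordsD coordsZ mxDE mxZE !hornerE mulrC.
  rewrite -/a -/b; have [a0|a0|a0] := ltgtP a 0.
  - have /near0_horner_gt0 : 0 < (- (a%:P + b *: 'X)).[0] by rewrite !hornerE oppr_gt0.
    by apply: filterS => e; rewrite E hornerN oppr_gt0 => /ltW; rewrite leNgt => /negbTE ->.
  - have /near0_horner_gt0 : 0 < (a%:P + b *: 'X).[0] by rewrite !hornerE.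
    by apply: filterS => e; rewrite E => ->.
  - by near=> e; rewrite E a0 !hornerE pmulr_lgt0.
by apply: filterS h => e he; apply: eq_forallb => i; rewrite he.
Unshelve. all: by end_near.
Qed.

Lemma half_open_uniq c y x S S' :
  S \in triangulation W c -> S' \in triangulation W c ->
  half_open y S x -> half_open y S' x -> S = S'.
Proof.
move=> SS SS'; have /filter_ex[e he] := half_open_near y x.
by rewrite !he; exact: (triangulation_uniq SS SS').
Qed.

Lemma half_open_exists c y x :
  (forall z, exists2 l : 'rV[R]_n, (forall j, 0 <= l 0 j) & l *m W = z) ->
  weight_ok W c -> generic W y ->
  exists2 S, S \in triangulation W c & half_open y S x.
Proof.
move=> cW cok gy; have /filter_ex[e [he ge]] : \forall e \near 0^'+,
  (forall S, half_open y S x = open_cone W S (x + e *: y)) /\ generic W (x + e *: y).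
  by near=> e; split; near: e; [exact: half_open_near | exact: near0_generic].
have [l l0 lz] := cW (x + e *: y).
have [S hS zS] := triangulation_exists cok ge l0 lz.
by exists S; rewrite // he.
Unshelve. all: by end_near.
Qed.

(** The lattice points of the half-open fundamental parallelepiped of the cone. *)
Definition box y S : set 'rV[R]_d :=
  [set p | lattice p /\ forall i, unit_itv (coords W S y 0 i) (coords W S p 0 i)].

Lemma finite_bounded_lattice (K : nat) :
  finite_set [set x : 'rV[R]_d | lattice x /\ forall i, `|x 0 i| <= K%:R].
Proof.
pose F (g : {ffun 'I_d -> 'I_(K + K).+1}) : 'rV[R]_d := \row_i ((g i)%:R - K%:R).
apply: (@sub_finite_set _ _ (F @` setT)); last exact: finite_image finite_finset.
move=> x [/mxOverP xi xK].
exists [ffun i : 'I_d => inord (absz (Num.floor (x 0 i) + K%:Z))] => //.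
apply/rowP => i; rewrite mxE ffunE.
have [k xk] : exists k : int, x 0 i = k%:~R by apply/intrP; exact: xi.
have := xK i; rewrite xk intrKfloor // -[K%:R]/((K%:Z)%:~R) -intr_norm ler_int => kK.
rewrite inordK; last by lia.
by rewrite natr_absz ger0_norm ?intrD ?addrK //; lia.
Qed.

Lemma finite_coords_lattice S (K : nat) : is_basis W S ->
  finite_set [set x : 'rV[R]_d | lattice x /\ forall i, `|coords W S x 0 i| <= K%:R].
Proof.
move=> bS; pose C := \sum_i \sum_j `|gens W S i j|.
have [K' hK'] : exists K' : nat, K%:R * C <= K'%:R.
  by exists (Num.truncn (K%:R * C)).+1; rewrite ltW // truncnS_gt.
apply: sub_finite_set (finite_bounded_lattice K') => x [xl xK]; split => // j.
rewrite (le_trans _ hK') // -(coordsK x bS) mxE (le_trans (ler_norm_sum _ _ _)) //.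
rewrite mulr_sumr ler_sum // => i _; rewrite normrM ler_pM //.
by rewrite (bigD1 j) //= lerDl sumr_ge0.
Qed.

Lemma finite_box y S : is_basis W S -> finite_set (box y S).
Proof.
move=> bS; apply: sub_finite_set (finite_coords_lattice 1 bS) => p [pl hp]; split => // i.
by rewrite ger0_norm ?(unit_itv_ge0 (hp i)) // (unit_itv_le1 (hp i)).
Qed.

Hypothesis W_int : W \is a mxOver Num.int.

Lemma gens_int S : gens W S \is a mxOver Num.int.
Proof. by apply/mxOverP => i j; rewrite restrE; exact/mxOverP. Qed.

Lemma lattice_comb S (k : 'I_#|S| -> int) : lattice ((\row_i (k i)%:~R) *m gens W S).
Proof.
by apply: mxOverM (gens_int S); apply/mxOverP => i j; rewrite mxE intr_int.
Qed.

End HalfOpenCones.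

Section Boxes.
Variables (R : realType) (d n : nat) (W : 'M[R]_(n, d)).
Hypothesis W_int : W \is a mxOver Num.int.
Implicit Types (S : {set 'I_n}) (x y z p : 'rV[R]_d) (c : 'cV[R]_n).

Lemma latticeD x y : lattice x -> lattice y -> lattice (x + y).
Proof. by move=> /mxOverP xl /mxOverP yl; apply/mxOverP => i j; rewrite mxE rpredD. Qed.

Lemma latticeB x y : lattice x -> lattice y -> lattice (x - y).
Proof. by move=> /mxOverP xl /mxOverP yl; apply/mxOverP => i j; rewrite !mxE rpredB. Qed.

Lemma box_decomp y S x : is_basis W S -> lattice x ->
  exists p (k : 'I_#|S| -> int), box W y S p /\ x = p + (\row_i (k i)%:~R) *m gens W S.
Proof.
move=> bS xl.
have /fin_all_exists[k hk] : forall i, exists k : int,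
    unit_itv (coords W S y 0 i) (coords W S x 0 i - k%:~R).
  by move=> i; exact: unit_itv_int_part.
exists (x - (\row_i (k i)%:~R) *m gens W S), k; split; last by rewrite addrNK.
split=> [|i]; first exact: latticeB xl (lattice_comb W_int k).
by rewrite -scaleN1r coordsD coordsZ coords_mul // mxDE mxZE mulN1r [X in _ - X]mxE.
Qed.

Lemma height_comb S p (t : 'rV[R]_#|S|) : is_basis W S ->
  height W S (p + t *m gens W S) = height W S p + \sum_i t 0 i.
Proof.
move=> bS; rewrite /height -big_split /=; apply: eq_bigr => i _.
by rewrite coordsD coords_mul // mxDE.
Qed.

Lemma box_height_ge0 y S p : box W y S p -> 0 <= height W S p.
Proof. by move=> [_ hp]; apply: sumr_ge0 => i _; exact: unit_itv_ge0 (hp i). Qed.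

Lemma box_height_le y S p : is_basis W S -> box W y S p -> height W S p <= d%:R.
Proof.
move=> bS [_ hp]; have -> : d%:R = \sum_(i < #|S|) 1 :> R by rewrite sumr_const card_ord (card_basis bS).
by apply: ler_sum => i _; exact: unit_itv_le1 (hp i).
Qed.

Section CountCone.
(** [P] is a condition on heights, and [k r] the shift it imposes on a box point of height [r]. The
    instances are [r <= m%:R] with the ceiling, and [r < m%:R] with the floor plus one. *)
Variables (P : R -> Prop) (m : nat) (k : R -> nat).
Hypothesis P_shift : forall r (j : nat), 0 <= r -> P (r + j%:R) <-> (j + k r <= m)%N.

(** Adding natural combinations of the generators to box points is a bijection onto the lattice
    points of the half-open cone: surjective by integer parts of the coordinates, injective by their
    uniqueness. *)
Lemma count_cone y S (Q : set 'rV[R]_d) : is_basis W S ->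
  (forall x, lattice x -> half_open W y S x -> Q x <-> P (height W S x)) ->
  let A := (Q `&` @lattice R d) `&` half_open W y S in
  finite_set A /\
  #|` fset_set A| = (\sum_(p <- fset_set (box W y S)) simplex_count d m (k (height W S p)))%N.
Proof.
move=> bS QP A; have fB := finite_box y bS.
pose tv (t : #|S|.-tuple nat) : 'rV[R]_#|S| := \row_i (tnth t i)%:~R.
have tvE (t : #|S|.-tuple nat) : \sum_i tv t 0 i = (\sum_(j <- t) j)%:R.
  by rewrite big_tuple natr_sum; apply: eq_bigr => i _; rewrite mxE.
have cE p (t : #|S|.-tuple nat) i :
    coords W S (p + tv t *m gens W S) 0 i = coords W S p 0 i + (tnth t i)%:~R.
  by rewrite coordsD coords_mul // mxDE [X in _ + X]mxE.
pose s := [seq p + tv t *m gens W S | p <- fset_set (box W y S),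
             t <- bounded_tuples #|S| m (k (height W S p))].
have [||fA ->] := @card_fset_setE _ A s; last first.
- split=> //; rewrite size_allpairs_dep sumnE big_map; apply: eq_bigr => p _.
  by rewrite size_bounded_tuples (card_basis bS).
- move=> x; split.
    move=> [[Qx xl] hx]; have [p [j [pB xE]]] := box_decomp y bS xl.
    have j0 i : 0 <= j i.
      have := half_openP W y S x; move: hx => /[swap] /[apply]/(_ i).
      by rewrite xE coordsD coords_mul // mxDE [X in _ + X]mxE half_open_int //; case: pB.
    pose t := [tuple `|j i|%N | i < #|S|].
    have jt : \row_i (j i)%:~R = tv t.
      by apply/rowP => i; rewrite !mxE tnth_mktuple -[j i in LHS]gez0_abs.
    rewrite jt in xE; rewrite xE; apply: allpairs_f_dep.
      by rewrite in_fset_set // mem_set.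
    rewrite mem_bounded_tuples; apply/P_shift; first exact: box_height_ge0 pB.
    by rewrite -tvE -height_comb // -xE; apply/QP.
  case/allpairsPdep => p [t []]; rewrite in_fset_set // => /set_mem pB.
  rewrite mem_bounded_tuples => /P_shift ht ->.
  have xl : lattice (p + tv t *m gens W S).
    by case: pB => pl _; apply: latticeD => //; exact: (lattice_comb W_int (fun i => tnth t i : int)).
  have hx : half_open W y S (p + tv t *m gens W S).
    apply/half_openP => i; rewrite cE half_open_int //; by case: pB.
  split => //; split => //; apply/QP => //; rewrite height_comb // tvE.
  by apply: ht; exact: box_height_ge0 pB.
apply: allpairs_uniq_dep => [|p _|]; [exact: fset_uniq | exact: uniq_bounded_tuples |].
move=> [p t] [p' t'] /allpairsPdep[q [u [qB _ [-> _]]]] /allpairsPdep[q' [u' [q'B _ [-> _]]]] /=.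
move=> e; have tt' : t = t'.
  apply: eq_from_tnth => i; apply/eqP; rewrite -eqz_nat -subr_eq0; apply/eqP.
  have [_ /(_ i) hq] : box W y S q by move: qB; rewrite in_fset_set // => /set_mem.
  have [_ /(_ i) hq'] : box W y S q' by move: q'B; rewrite in_fset_set // => /set_mem.
  apply: unit_itv_inj hq _; rewrite intrB addrA.
  have := cE q t i; rewrite e cE => <-.
  by rewrite addrK.
by move: e; rewrite tt' => /addIr ->.
Qed.

End CountCone.

Variables (c : 'cV[R]_n) (y : 'rV[R]_d).
Hypothesis W_cone : forall z, exists2 l : 'rV[R]_n, (forall j, 0 <= l 0 j) & l *m W = z.
Hypothesis c_ok : weight_ok W c.

(** A list, since heights count with multiplicity. *)
Definition box_heights y : seq R :=
  [seq height W B p | B <- enum (triangulation W c), p <- fset_set (box W y B)].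

Lemma triangulation_basis S : S \in triangulation W c -> is_basis W S.
Proof. by rewrite inE => /andP[]. Qed.

Lemma mem_box_heights r : reflect
  (exists S p, [/\ S \in triangulation W c, box W y S p & r = height W S p])
  (r \in box_heights y).
Proof.
apply: (iffP allpairsPdep) => [[S [p [SE pB ->]]]|[S [p [ST pB ->]]]]; exists S, p.
  rewrite mem_enum in SE; split => //.
  by move: pB; rewrite in_fset_set => [/set_mem//|]; exact/finite_box/triangulation_basis.
split; rewrite ?mem_enum // in_fset_set ?mem_set //.
exact/finite_box/triangulation_basis.
Qed.

Lemma count_lattice (P : R -> Prop) m (k : R -> nat) (Q : set 'rV[R]_d) :
  generic W y ->
  (forall r (j : nat), 0 <= r -> P (r + j%:R) <-> (j + k r <= m)%N) ->
  (forall S x, S \in triangulation W c -> lattice x -> half_open W y S x ->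
    Q x <-> P (height W S x)) ->
  finite_set (Q `&` @lattice R d) /\
  num_lattice_points Q = (\sum_(r <- box_heights y) simplex_count d m (k r))%N.
Proof.
move=> gy Pk QP.
have cnt S : S \in triangulation W c -> _ := fun ST =>
  count_cone Pk (triangulation_basis ST) (fun x => QP S x ST).
have [|||fQ cQ] := @card_fset_set_partition _ _ (triangulation W c)
    (Q `&` @lattice R d) (half_open W y).
- by move=> x _; have [S ST hS] := half_open_exists x W_cone c_ok gy; exists S.
- by move=> x S S' _ ST S'T; exact: half_open_uniq ST S'T.
- by move=> S ST; case: (cnt S ST).
split => //; rewrite /num_lattice_points cQ /box_heights big_allpairs_dep big_enum /=.
by apply: eq_bigr => S ST; case: (cnt S ST).
Qed.

End Boxes.

Section Reflection.
Variables (R : realType) (d n : nat) (W : 'M[R]_(n, d)).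
Hypothesis W_int : W \is a mxOver Num.int.
Variables (c : 'cV[R]_n) (y : 'rV[R]_d).
Hypothesis gy : generic W y.

(* [p |-> (sum of the generators) - p] exchanges the boxes of [y] and [- y]. *)
Lemma big_box_heights_opp (F : R -> nat) :
  (\sum_(r <- box_heights W c (- y)) F r = \sum_(r <- box_heights W c y) F (d%:R - r)%R)%N.
Proof.
rewrite /box_heights !big_allpairs_dep; apply: eq_big_seq => S.
rewrite mem_enum => /triangulation_basis bS.
pose v : 'rV[R]_#|S| := const_mx 1.
have vE : v = \row_i (1%:Z)%:~R by apply/rowP => i; rewrite !mxE.
have vl : lattice (v *m gens W S) by rewrite vE; exact: lattice_comb.
have cE p i : coords W S (v *m gens W S - p) 0 i = 1 - coords W S p 0 i.
  by rewrite -scaleN1r coordsD coordsZ coords_mul // mxDE mxZE mulN1r [X in X - _]mxE.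
have bE p : box W (- y) S (v *m gens W S - p) <-> box W y S p.
  have h i : unit_itv (coords W S (- y) 0 i) (coords W S (v *m gens W S - p) 0 i) =
      unit_itv (coords W S y 0 i) (coords W S p 0 i).
    rewrite cE -scaleN1r coordsZ mxZE mulN1r unit_itv_opp //.
    by case: gy => _; exact.
  split=> -[pl hp]; split.
  - by rewrite -[p](subKr (v *m gens W S)); exact: latticeB.
  - by move=> i; rewrite -h.
  - exact: latticeB.
  - by move=> i; rewrite h.
have hE p : height W S (v *m gens W S - p) = d%:R - height W S p.
  rewrite /height (eq_bigr _ (fun i _ => cE p i)) sumrB sumr_const card_ord.
  by congr (_%:R - _); exact: card_basis bS.
have fB := finite_box y bS; have fB' := finite_box (- y) bS.
rewrite -(eq_bigr _ (fun p _ => congr1 F (hE p))).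
rewrite -(big_map (fun p => v *m gens W S - p) xpredT (fun p => F (height W S p))).
apply: perm_big; apply: uniq_perm; first exact: fset_uniq.
  by rewrite map_inj_uniq ?fset_uniq // => p q /addrI/oppr_inj.
move=> p; rewrite in_fset_set //; apply/idP/mapP => [/set_mem pB|[q qB ->]].
  exists (v *m gens W S - p); last by rewrite subKr.
  by rewrite in_fset_set // mem_set //; apply/bE; rewrite subKr.
by apply/mem_set/bE; move: qB; rewrite in_fset_set // => /set_mem.
Qed.

End Reflection.

(** * Dilates and heights *)

Section Dilates.
Variables (R : realType) (d : nat).
Implicit Types (P A : set 'rV[R]_d) (x y v w p q : 'rV[R]_d) (t s : R).

Lemma convexP A : @convex_set R 'rV[R]_d A <->
  (forall x y t, 0 <= t <= 1 -> A x -> A y -> A (t *: x + (1 - t) *: y)).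
Proof.
split=> [cA x y t /andP[t0 t1] Ax Ay|cA x y k /set_mem Ax /set_mem Ay].
  by have := cA x y (Itv01 t0 t1) (mem_set Ax) (mem_set Ay) => /set_mem.
by apply/mem_set/cA => //; apply/andP; split; [exact: ge0 | exact: le1].
Qed.

(** Real factors are needed for the gauge; [dilate m P] is convertible to [dil m%:R P]. *)
Definition dil t P : set 'rV[R]_d := [set t *: x | x in P].

Lemma dil1 P : dil 1 P = P.
Proof. by apply/seteqP; split=> [_ [x Px <-]|x Px]; [rewrite scale1r | exists x; rewrite ?scale1r]. Qed.

Lemma nbhs_ray A x v : nbhs x A -> exists2 e, 0 < e & A (x + e *: v).
Proof.
move=> /nbhs_normP[r /= r0 xA]; have v0 : 0 < `|v| + 1 by rewrite ltr_wpDl.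
have e0 : 0 < r / (`|v| + 1) by exact: divr_gt0.
exists (r / (`|v| + 1)) => //.
apply: xA => /=; rewrite /ball_ opprD addNKr normrN normrZ gtr0_norm //.
by rewrite mulrAC ltr_pdivrMr // ltr_pM2l // ltrDl.
Qed.

Section ConvexWithZero.
Variable P : set 'rV[R]_d.
Hypothesis P_convex : @convex_set R 'rV[R]_d P.

Lemma dilD t s x y : 0 <= t -> 0 <= s -> dil t P x -> dil s P y -> dil (t + s) P (x + y).
Proof.
move=> t0 s0 [p Pp <-] [q Pq <-]; have [e|ne] := eqVneq (t + s) 0.
  have := paddr_eq0 t0 s0; rewrite e eqxx => /esym/andP[/eqP -> /eqP ->].
  by exists p; rewrite ?scale0r ?addr0.
have ts0 : 0 < t + s by rewrite lt_neqAle eq_sym ne addr_ge0.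
exists ((t / (t + s)) *: p + (1 - t / (t + s)) *: q).
  apply: (convexP P).1 => //; apply/andP; split; first exact: divr_ge0 (ltW ts0).
  by rewrite ler_pdivrMr // mul1r lerDl.
rewrite scalerDr !scalerA mulrCA divff // mulr1 mulrBr mulr1 mulrCA divff // mulr1.
by rewrite [t + s - t]addrAC subrr add0r.
Qed.

Hypothesis P0 : P 0.

Lemma dil0 t : dil t P 0.
Proof. by exists 0; rewrite ?scaler0. Qed.

Lemma dil_le t s x : 0 <= t -> t <= s -> dil t P x -> dil s P x.
Proof.
move=> t0 ts tx; rewrite -[s](subrKC t) -[x]addr0.
by apply: dilD; rewrite ?subr_ge0 //; exact: dil0.
Qed.

Lemma dil_sum k (a : 'I_k -> R) (v : 'I_k -> 'rV[R]_d) :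
  (forall i, 0 <= a i) -> (forall i, P (v i)) -> dil (\sum_i a i) P (\sum_i a i *: v i).
Proof.
move=> a0 Pv; suff : 0 <= \sum_i a i /\ dil (\sum_i a i) P (\sum_i a i *: v i) by case.
elim/big_ind2 : _ => [|t x s y [t0 tx] [s0 sy]|i _].
- by split=> //; exact: dil0.
- by split; [exact: addr_ge0 | exact: dilD].
- by split=> //; exists (v i).
Qed.

End ConvexWithZero.

End Dilates.

(** * The height on each cone is the gauge of the polytope *)

Section Gauge.
Variables (R : realType) (d n : nat) (W : 'M[R]_(n, d)) (P : set 'rV[R]_d).
Hypothesis W_int : W \is a mxOver Num.int.
Hypothesis P_convex : @convex_set R 'rV[R]_d P.
Hypothesis P_gen : forall i, P (row i W).
Hypothesis P_min : forall C : set 'rV[R]_d,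
  @convex_set R 'rV[R]_d C -> (forall i, C (row i W)) -> P `<=` C.
Hypothesis P_nbhs0 : nbhs (0 : 'rV[R]_d) P.
Variable c : 'cV[R]_n.
Hypothesis c_ok : weight_ok W c.
Implicit Types (S : {set 'I_n}) (x y z w : 'rV[R]_d) (t : R).

Lemma P_0 : P 0. Proof. exact: nbhs_singleton. Qed.

Lemma heightD S x y : height W S (x + y) = height W S x + height W S y.
Proof. by rewrite /height -big_split; apply: eq_bigr => i _; rewrite coordsD mxDE. Qed.

Lemma heightZ S a x : height W S (a *: x) = a * height W S x.
Proof. by rewrite /height mulr_sumr; apply: eq_bigr => i _; rewrite coordsZ mxZE. Qed.

(** A small positive multiple of [z] lies in [P], which is contained in the convex set of
    nonnegative combinations of generators. *)
Lemma positive_span z : exists2 l : 'rV[R]_n, (forall j, 0 <= l 0 j) & l *m W = z.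
Proof.
have [e e0] := nbhs_ray z P_nbhs0; rewrite add0r.
have sub : P `<=` [set x | exists2 l : 'rV[R]_n, (forall j, 0 <= l 0 j) & l *m W = x].
  apply: P_min => [|i]; last first.
    by exists (delta_mx 0 i); [move=> j; rewrite mxE | rewrite -rowE].
  apply/convexP => x y t /andP[t0 t1] [l l0 <-] [l' l'0 <-].
  exists (t *: l + (1 - t) *: l'); last by rewrite mulmxDl -!scalemxAl.
  by move=> j; rewrite mxDE !mxZE addr_ge0 // mulr_ge0 // subr_ge0.
move=> /sub[l l0 lz]; exists (e^-1 *: l).
  by move=> j; rewrite mxZE mulr_ge0 // invr_ge0 ltW.
by rewrite -scalemxAl lz scalerA mulVf ?scale1r // gt_eqF.
Qed.

Lemma coords_gen S (i : 'I_#|S|) : is_basis W S -> coords W S (row (enum_val i) W) = delta_mx 0 i.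
Proof.
move=> bS; rewrite (_ : row _ W = delta_mx 0 i *m gens W S) ?coords_mul //.
by rewrite -rowE row_rowsub.
Qed.

Lemma height_gen S i : is_basis W S -> i \in S -> height W S (row i W) = 1.
Proof.
move=> bS iS; have [k ->] := enum_val_ex iS; rewrite /height coords_gen //.
by rewrite (bigD1 k) //= mxE !eqxx big1 ?addr0 // => j jk; rewrite mxE (negbTE jk).
Qed.

(** Here the last clause of [weight_ok] enters: no generator lies beyond the hyperplane through the
    generators of a cone of the triangulation. *)
Lemma height_le1 S i : S \in triangulation W c -> height W S (row i W) <= 1.
Proof.
rewrite inE => /andP[bS /forallP/(_ i)/implyP hS].
have [iS|iS] := boolP (i \in S); first by rewrite height_gen.
by case: c_ok => _ /(_ S i bS iS)[_]; apply; exact: hS.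
Qed.

Lemma height_le_dil S t x : S \in triangulation W c -> 0 <= t -> dil t P x ->
  height W S x <= t.
Proof.
move=> ST t0 [p Pp <-]; rewrite heightZ -[leRHS]mulr1 ler_wpM2l //.
apply: (P_min (C := [set p | height W S p <= 1])) Pp => [|i]; last exact: height_le1.
apply/convexP => x0 y s /andP[s0 s1] /= hx hy; rewrite heightD !heightZ.
have := ler_wpM2l s0 hx; have : 0 <= 1 - s by rewrite subr_ge0.
by move=> s1' ; have := ler_wpM2l s1' hy; lra.
Qed.

Lemma dil_height S x : is_basis W S -> (forall i, 0 <= coords W S x 0 i) ->
  dil (height W S x) P x.
Proof.
move=> bS x0; rewrite -[in X in dil _ _ X](coordsK x bS).
have -> : coords W S x *m gens W S = \sum_i coords W S x 0 i *: row (enum_val i) W.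
  rewrite mulmx_sum_row; apply: eq_bigr => i _; congr (_ *: _).
  by rewrite row_rowsub.
by apply: dil_sum => //; exact: P_0.
Qed.

Lemma small_dil : exists2 r, 0 < r & forall e w, 0 < e -> `|w| < e * r -> dil e P w.
Proof.
have /nbhs_normP[r /= r0 rP] := P_nbhs0; exists r => // e w e0 we.
exists (e^-1 *: w); last by rewrite scalerA divff ?scale1r // gt_eqF.
apply: rP; rewrite /= /ball_ sub0r normrN normrZ gtr0_norm ?invr_gt0 //.
by rewrite mulrC ltr_pdivrMr // mulrC.
Qed.

Section Levels.
Variables (y : 'rV[R]_d) (S : {set 'I_n}) (x : 'rV[R]_d).
Hypothesis ST : S \in triangulation W c.
Hypothesis hx : half_open W y S x.

Let bS : is_basis W S. Proof. exact: triangulation_basis ST. Qed.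
Let x_ge0 i : 0 <= coords W S x 0 i. Proof. exact: half_open_coord_ge0 hx. Qed.
Let height_ge0 : 0 <= height W S x. Proof. exact: sumr_ge0. Qed.

Lemma dilate_height m : dilate m P x <-> height W S x <= m%:R.
Proof.
split=> [|h]; first exact: height_le_dil.
by apply: (dil_le P_convex P_0 _ h); [exact: height_ge0 | exact: dil_height].
Qed.

(** An interior point can be pushed outwards along its own ray, which increases a positive height.
    Conversely the slack [m%:R - height W S x] leaves room for a small dilate of [P], hence for a
    ball. *)
Lemma interior_dilate_height m : (0 < m)%N -> (dilate m P)° x <-> height W S x < m%:R.
Proof.
move=> m0; split=> [/(nbhs_ray x)[e e0]|h].
  rewrite -{1}[x]scale1r -scalerDl => /(height_le_dil ST (ler0n _ _)); rewrite heightZ.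
  have [h0|h0 _] := ltP 0 (height W S x); last by rewrite (le_lt_trans h0) // ltr0n.
  by apply: lt_le_trans; rewrite mulrDl mul1r ltrDl mulr_gt0.
have [r r0 rP] := small_dil; suff : nbhs x (dilate m P) by [].
apply: ((nbhs_normP x (dilate m P)).2).
exists ((m%:R - height W S x) * r) => /=; first by rewrite mulr_gt0 // subr_gt0.
move=> z /=; rewrite /ball_ distrC => xz.
rewrite -(subrKC x z); change (dil m%:R P (x + (z - x))).
rewrite -(subrKC (height W S x) m%:R).
apply: dilD => //; first by rewrite subr_ge0 ltW.
  exact: dil_height.
by apply: rP; rewrite // subr_gt0.
Qed.

Lemma closure_dilate_height m : closure (dilate m P) x <-> height W S x <= m%:R.
Proof.
split=> [cx|/dilate_height]; last exact: subset_closure.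
apply/ler_addgt0Pr => e e0; have [r r0 rP] := small_dil.
have /cx[z [zP /= xz]] : nbhs x [set z | `|x - z| < e * r].
  by apply: (nbhs_normP x _).2; exists (e * r) => //=; exact: mulr_gt0.
have {}xz : dil e P (x - z) by apply: rP.
apply: (height_le_dil ST); first by rewrite addr_ge0 // ltW.
by rewrite -(subrKC z x); apply: dilD; rewrite // ltW.
Qed.

End Levels.
End Gauge.

(** * The dual polytope *)

Section Farkas.
Variables (R : realFieldType) (m : nat).
Implicit Types (a b : 'rV[R]_m) (x : 'cV[R]_m) (s : seq 'rV[R]_m).

Fixpoint in_cone s b : Prop :=
  if s is a :: s' then exists2 t, 0 <= t & in_cone s' (b - t *: a) else b = 0.

(** Induction on the number of vectors: an [x] separating [b] from the tail either handles [a] too,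
    or is positive at [a] and allows a projection along [a]. *)
Lemma farkas s b : in_cone s b \/
  exists x, (forall a, a \in s -> (a *m x) 0 0 <= 0) /\ 0 < (b *m x) 0 0.
Proof.
have [k] := ubnP (size s); elim: k s b => // k IH [|a s] b sk.
  have [->|b0] := eqVneq b 0; first by left.
  right; exists b^T; split => //; rewrite lt_neqAle; apply/andP; split; last first.
    by rewrite mxE sumr_ge0 // => i _; rewrite mxE -expr2 sqr_ge0.
  apply: contraNneq b0 => /esym; rewrite mxE => /eqP.
  rewrite psumr_eq0 => [/allP h|i _]; last by rewrite mxE -expr2 sqr_ge0.
  apply/eqP/rowP => i; have := h i (mem_index_enum _).
  by rewrite !mxE /= mulf_eq0 orbb => /eqP.
have {}sk : (size s < k)%N by [].
have [h|[x [xs xb]]] := IH s b sk; first by left; exists 0; rewrite // scale0r subr0.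
have [ax|ax] := leP ((a *m x) 0 0) 0.
  by right; exists x; split=> // v; rewrite inE => /predU1P[->|/xs].
(* Project along [a] onto the hyperplane orthogonal to [x]. *)
pose pr v := v - ((v *m x) 0 0 / (a *m x) 0 0) *: a.
have sk' : (size (map pr s) < k)%N by rewrite size_map.
have [h|[z [zs zb]]] := IH (map pr s) (pr b) sk'.
  (* Undoing the projection can only raise the coefficient of [a] above its nonnegative starting
     value, because [x] is nonpositive on [s]. *)
  left; have : exists2 t, (b *m x) 0 0 / (a *m x) 0 0 <= t & in_cone s (b - t *: a).
    move: h; rewrite [pr b]/pr; move: (_ / _) => t0 h.
    elim: s b t0 xs h {xb IH sk sk'} => [|v s IHs] b t0 xs /=.
 by move=> e; exists t0.
    move=> [r r0]; set t1 := t0 - r * ((v *m x) 0 0 / (a *m x) 0 0).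
    have -> : b - t0 *: a - r *: pr v = (b - r *: v) - t1 *: a.
      rewrite /pr /t1 scalerBr scalerA scalerBl !opprB addrACA [RHS]addrACA.
      by congr (_ + _); rewrite addrC.
    move=> /(IHs _ _ (fun u us => xs u (mem_behead (s := v :: s) us)))[t t1t tc].
    exists t; last by exists r => //; rewrite addrAC.
    rewrite (le_trans _ t1t) // /t1 lerDl oppr_ge0 mulr_ge0_le0 // mulr_le0_ge0 //.
      by apply: xs; rewrite mem_head.
    by rewrite invr_ge0 ltW.
  case=> t tb tc; exists t => //; rewrite (le_trans _ tb) // divr_ge0 // ltW //.
(* This is [z] composed with the projection; in particular it vanishes on [a]. *)
right; exists (z - ((a *m z) 0 0 / (a *m x) 0 0) *: x).
have prE v : (v *m (z - ((a *m z) 0 0 / (a *m x) 0 0) *: x)) 0 0 = (pr v *m z) 0 0.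
  have entry (A B : 'M[R]_1) k' : (A - k' *: B) 0 0 = A 0 0 - k' * B 0 0 by rewrite !mxE.
  rewrite /pr mulmxBl -scalemxAl mulmxBr -scalemxAr !entry.
  congr (_ - _); rewrite mulrAC [RHS]mulrAC.
  by rewrite [X in X / _]mulrC.
split=> [v|]; last by rewrite prE.
rewrite inE => /predU1P[->|vs]; rewrite prE; last by apply: zs; exact: map_f.
by rewrite /pr divff ?gt_eqF // scale1r subrr mul0mx mxE.
Qed.

End Farkas.

Section Dual.
Variables (R : realType) (d n : nat) (W : 'M[R]_(n, d)) (P : set 'rV[R]_d).
Hypothesis W_int : W \is a mxOver Num.int.
Hypothesis P_convex : @convex_set R 'rV[R]_d P.
Hypothesis P_gen : forall i, P (row i W).
Hypothesis P_min : forall C : set 'rV[R]_d,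
  @convex_set R 'rV[R]_d C -> (forall i, C (row i W)) -> P `<=` C.
Hypothesis P_nbhs0 : nbhs (0 : 'rV[R]_d) P.
Variables (c : 'cV[R]_n) (y : 'rV[R]_d).
Hypothesis c_ok : weight_ok W c.
Hypothesis y_gen : generic W y.
Implicit Types (S : {set 'I_n}) (x z u v : 'rV[R]_d) (t : R).

Definition dot u v : R := \sum_(i < d) u 0 i * v 0 i.

Lemma dotDl u u' v : dot (u + u') v = dot u v + dot u' v.
Proof. by rewrite /dot -big_split; apply: eq_bigr => i _; rewrite mxDE mulrDl. Qed.

Lemma dotZl t u v : dot (t *: u) v = t * dot u v.
Proof. by rewrite /dot mulr_sumr; apply: eq_bigr => i _; rewrite mxZE mulrA. Qed.

Lemma dotZr t u v : dot u (t *: v) = t * dot u v.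
Proof. by rewrite /dot mulr_sumr; apply: eq_bigr => i _; rewrite mxZE mulrCA. Qed.

Lemma dot_sumr u k (a : 'I_k -> R) (v : 'I_k -> 'rV[R]_d) :
  dot u (\sum_i a i *: v i) = \sum_i a i * dot u (v i).
Proof.
rewrite /dot; under eq_bigr do rewrite summxE mulr_sumr.
rewrite exchange_big; apply: eq_bigr => i _; rewrite mulr_sumr.
by apply: eq_bigr => j _; rewrite mxZE mulrCA.
Qed.

Lemma dual_convex : @convex_set R 'rV[R]_d (dual P).
Proof.
apply/convexP => u v t /andP[t0 t1] hu hv w Pw.
have h1 : dot u w <= 1 := hu w Pw; have h2 : dot v w <= 1 := hv w Pw.
change (dot (t *: u + (1 - t) *: v) w <= 1); rewrite dotDl !dotZl.
have t1' : 0 <= 1 - t by rewrite subr_ge0.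
have := ler_wpM2l t0 h1; have := ler_wpM2l t1' h2; lra.
Qed.

(** The vector representing the height of [S]; for a basis it has value 1 on all generators in
    [S]. *)
Definition facet S : 'rV[R]_d := \row_j height W S (delta_mx 0 j).

Lemma dot_facet S x : dot (facet S) x = height W S x.
Proof.
rewrite [in RHS](row_sum_delta x) /dot; elim/big_ind2 : _ => [|u a v b -> ->|j _].
- by rewrite -(scale0r (0 : 'rV[R]_d)) heightZ mul0r.
- by rewrite heightD.
- by rewrite heightZ mxE mulrC.
Qed.

Lemma facet_dual S : S \in triangulation W c -> dual P (facet S).
Proof.
move=> ST v Pv; change (dot (facet S) v <= 1); rewrite dot_facet.
by apply: (height_le_dil P_min c_ok ST ler01); rewrite dil1.
Qed.

Lemma facet_unique S u : S \in triangulation W c ->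
  (forall i, i \in S -> dot u (row i W) = 1) -> u = facet S.
Proof.
move=> ST hu; have bS := triangulation_basis ST.
have uE x : dot u x = height W S x.
  rewrite -{1}(coordsK x bS) mulmx_sum_row dot_sumr; apply: eq_bigr => i _.
  by rewrite row_rowsub hu ?mulr1 // enum_valP.
apply/rowP => j; rewrite mxE -uE /dot (bigD1 j) //= big1 ?addr0 => [|i ij].
  by rewrite mxE !eqxx mulr1.
by rewrite mxE (negbTE ij) andbF mulr0.
Qed.

(* [facet S] is an extreme point: removing it from the dual leaves a convex set. *)
Lemma facet_vertex (U : set 'rV[R]_d) S : S \in triangulation W c ->
  dual P = conv_hull U -> U (facet S).
Proof.
move=> ST dU; apply: contrapT => nU; have bS := triangulation_basis ST.
have sU : U `<=` dual P by rewrite dU; exact: sub_gen_smallest.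
suff : conv_hull U `<=` [set u | dual P u /\ u <> facet S].
  by rewrite -dU => /(_ _ (facet_dual ST))[_]; apply.
apply: smallest_sub => [|u Uu]; last by split; [exact: sU | move=> e; apply: nU; rewrite -e].
apply/convexP => u v t /andP[t0 t1] [hu nu] [hv nv]; split.
  by apply: (convexP _).1 dual_convex _ _ _ _ hu hv; rewrite t0 t1.
move=> e; have [t00|t00] := eqVneq t 0.
  by apply: nv; rewrite -e t00 scale0r add0r subr0 scale1r.
apply: nu; apply: facet_unique ST _ => i iS; apply/eqP; rewrite eq_le.
have h1 : dot u (row i W) <= 1 := hu _ (P_gen i).
have h2 : dot v (row i W) <= 1 := hv _ (P_gen i).
rewrite h1 /=; have := height_gen bS iS; rewrite -dot_facet -e dotDl !dotZl => hE.
have t1' : 0 <= 1 - t by rewrite subr_ge0.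
have h3 := ler_wpM2l t1' h2; have tp : 0 < t by rewrite lt_neqAle eq_sym t00.
by rewrite -(ler_pM2l tp); lra.
Qed.

(** Homogenization: the appended coordinate 1 records the total weight, so a conic combination of
    total weight [t] is [t] times a convex one. Weight 0 forces all coefficients to vanish. *)
Lemma in_cone_conv (C : set 'rV[R]_d) (s : seq 'rV[R]_d) u t :
  @convex_set R 'rV[R]_d C -> (forall a, a \in s -> C a) ->
  in_cone [seq row_mx a (1%:M : 'M_1) | a <- s] (row_mx u t%:M) ->
  0 <= t /\ if t == 0 then u = 0 else dil t C u.
Proof.
move=> cC; elim: s u t => [|a s IH] u t sC /=.
  move=> /eqP; rewrite row_mx_eq0 => /andP[/eqP -> /eqP/matrixP/(_ 0 0)].
  by rewrite !mxE eqxx mulr1n => ->; rewrite eqxx.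
case=> r r0; rewrite scale_row_mx opp_row_mx add_row_mx scale_scalar_mx mulr1 -raddfB /=.
have Ca : C a by apply: sC; rewrite mem_head.
move=> /IH[b bs|tr0]; first by apply: sC; rewrite inE bs orbT.
have t0 : 0 <= t by rewrite -(subrK r t) addr_ge0.
have [/eqP|tr] := eqVneq (t - r) 0.
  rewrite subr_eq0 => /eqP tr /eqP; rewrite subr_eq0 => /eqP ->; split=> //.
  by rewrite -tr; case: eqP => [->|_]; [rewrite scale0r | exists a].
move=> hu; split => //; rewrite ifF; last first.
  by apply/negbTE; rewrite gt_eqF // -(subrK r t) ltr_wpDr // lt_neqAle eq_sym tr.
by rewrite -[t](subrK r) -[u](subrK (r *: a)); apply: dilD => //; exists a.
Qed.

(** Were [u] outside the hull, Farkas would give [z] and [r] with [dot u z + r] positive but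
    [dot (facet S) z + r] nonpositive for all cones. On the cone containing [z] the latter product
    is the gauge of [z], which bounds [dot u z]. *)
Lemma dual_facets : dual P = conv_hull [set facet S | S in [set S | S \in triangulation W c]].
Proof.
set F := [set facet S | S in _]; apply/seteqP; split; last first.
  by apply: smallest_sub dual_convex _ => _ [S ST <-]; exact: facet_dual.
move=> u hu; have [|[x [xs xu]]] := farkas
    [seq row_mx (facet B) (1%:M : 'M_1) | B <- enum (triangulation W c)] (row_mx u 1%:M).
  rewrite (map_comp (fun a => row_mx a 1%:M) facet).
  have cF : @convex_set R 'rV[R]_d (conv_hull F).
    by apply/convexP => v w t t01 hv hw C [cC FC]; apply: (convexP C).1 => //; [exact: hv | exact: hw].
  case/(in_cone_conv cF) => [_ /mapP[S ST ->]|_].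
    by apply: sub_gen_smallest; exists S => //; rewrite /= -mem_enum.
  by rewrite oner_eq0 dil1.
pose z : 'rV[R]_d := (usubmx x)^T; pose r := dsubmx x 0 0.
have xE v : (row_mx v (1%:M : 'M_1) *m x) 0 0 = dot v z + r.
  rewrite -[x]vsubmxK mul_row_col mul1mx mxE; congr (_ + _).
  by rewrite mxE; apply: eq_bigr => i _; rewrite [z 0 i]mxE.
have [S ST hz] := half_open_exists z (positive_span P_min P_nbhs0) c_ok y_gen.
have := xs _ (map_f _ (_ : S \in enum _)); rewrite mem_enum ST => /(_ isT).
rewrite xE dot_facet => h1; move: xu; rewrite xE => h2.
have bS := triangulation_basis ST.
have z0 i : 0 <= coords W S z 0 i by exact: half_open_coord_ge0 hz.
have [p Pp pz] := dil_height P_convex P_gen P_nbhs0 bS z0.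
have h0 : 0 <= height W S z by exact: sumr_ge0.
have hup : dot u p <= 1 := hu p Pp.
have : dot u z <= height W S z by rewrite -[in leLHS]pz dotZr -[leRHS]mulr1 ler_wpM2l.
by move=> h3; lra.
Qed.

(** Box heights are values of facet vectors at lattice points. Conversely an entry of a facet vector
    is the height of a unit vector, which differs from a box height by an integer. *)
Lemma dual_lattice_polytopeP : lattice_polytope (dual P) <->
  (forall r, r \in box_heights W c y -> r \is a Num.int).
Proof.
split=> [[U [_ UL dU]] r /(mem_box_heights)[S [p [ST [pl _] ->]]]|hint].
  have /mxOverP fl : lattice (facet S) by apply: UL; exact: facet_vertex dU.
  rewrite -dot_facet rpred_sum // => i _; rewrite rpredM //.
  by move/mxOverP: pl.
exists [set facet S | S in [set S | S \in triangulation W c]]; split; last exact: dual_facets.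
  by apply: finite_image; exact: finite_finset.
move=> _ [S ST <-]; apply/mxOverP => i j; rewrite mxE.
have bS := triangulation_basis ST.
have el : lattice (delta_mx 0 j : 'rV[R]_d).
  by apply/mxOverP => i' j'; rewrite mxE; case: (_ && _); rewrite ?rpred0 ?rpred1.
have [p [k [pB ->]]] := box_decomp W_int y bS el.
rewrite height_comb // rpredD //.
  by apply: hint; apply/mem_box_heights; exists S, p.
by apply: rpred_sum => i' _; rewrite mxE intr_int.
Qed.

End Dual.

(** * Evaluating the functional *)

Section Counts.
Variables (R : realType) (d n : nat) (W : 'M[R]_(n, d)) (P : set 'rV[R]_d).
Hypothesis W_int : W \is a mxOver Num.int.
Hypothesis P_convex : @convex_set R 'rV[R]_d P.
Hypothesis P_gen : forall i, P (row i W).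
Hypothesis P_min : forall C : set 'rV[R]_d,
  @convex_set R 'rV[R]_d C -> (forall i, C (row i W)) -> P `<=` C.
Hypothesis P_nbhs0 : nbhs (0 : 'rV[R]_d) P.
Variables (c : 'cV[R]_n).
Hypothesis c_ok : weight_ok W c.
Implicit Types (S : {set 'I_n}) (x y z : 'rV[R]_d) (r : R) (m : nat).

Let W_cone := positive_span P_min P_nbhs0.

Lemma count_dilate y m : generic W y -> finite_set (dilate m P `&` @lattice R d) /\
  num_lattice_points (dilate m P) =
    (\sum_(r <- box_heights W c y) simplex_count d m `|Num.ceil r|)%N.
Proof.
move=> gy; apply: (count_lattice W_int W_cone c_ok (P := fun r => r <= m%:R)) gy _ _.
  move=> r j r0; have c0 : 0 <= Num.ceil r by rewrite ceil_ge0 (lt_le_trans _ r0) ?ltrN10.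
  rewrite -lerBrDr -[m%:R]/((m%:Z)%:~R) -[j%:R]/((j%:Z)%:~R) -intrB -ceil_le_int.
  move: (Num.ceil r) c0 => k k0; by split=> h; lia.
by move=> S x ST _ hx; apply: (dilate_height P_convex P_gen P_min P_nbhs0 c_ok ST hx).
Qed.

Lemma count_interior y m : (0 < m)%N -> generic W y ->
  finite_set ((dilate m P)° `&` @lattice R d) /\
  num_lattice_points (dilate m P)° =
    (\sum_(r <- box_heights W c y) simplex_count d m `|Num.floor r|.+1)%N.
Proof.
move=> m0 gy; apply: (count_lattice W_int W_cone c_ok (P := fun r => r < m%:R)
  (k := fun r => `|Num.floor r|.+1)) gy _ _.
  move=> r j r0; have c0 : 0 <= Num.floor r by rewrite floor_ge0.
  rewrite -ltrBrDr -[m%:R]/((m%:Z)%:~R) -[j%:R]/((j%:Z)%:~R) -intrB -floor_lt_int.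
  move: (Num.floor r) c0 => k k0; by split=> h; lia.
by move=> S x ST _ hx; apply: (interior_dilate_height P_convex P_gen P_min P_nbhs0 c_ok ST hx).
Qed.

Lemma num_boundary_pointsE y m : (0 < m)%N -> generic W y ->
  (num_boundary_points P m)%:R =
  (num_lattice_points (dilate m P))%:R - (num_lattice_points (dilate m P)°)%:R :> R.
Proof.
move=> m0 gy; rewrite /num_boundary_points gtn_eqF // /num_lattice_points.
have [fD _] := count_dilate m gy; have [fI _] := count_interior m0 gy.
have -> : boundary (dilate m P) `&` @lattice R d =
    (dilate m P `&` @lattice R d) `\` ((dilate m P)° `&` @lattice R d).
  have cl x : closure (dilate m P) x <-> dilate m P x.
    have [S ST hx] := half_open_exists x W_cone c_ok gy.
    by rewrite (closure_dilate_height P_convex P_gen P_min P_nbhs0 c_ok ST hx)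
      -(dilate_height P_convex P_gen P_min P_nbhs0 c_ok ST hx).
  apply/seteqP; split => x; first by move=> [[/cl Dx nI] xl]; split => // -[].
  by move=> [[Dx xl] nI]; split => //; split; [exact/cl | move=> Ix; apply: nI].
have sub : (fset_set ((dilate m P)° `&` @lattice R d)
            `<=` fset_set (dilate m P `&` @lattice R d))%fset.
  apply/fsubsetP => x; rewrite !in_fset_set // => /set_mem[Ix xl].
  by rewrite mem_set //; split => //; exact: interior_subset Ix.
by rewrite fset_setD // cardfsDS // natrB // fsubset_leq_card.
Qed.

Lemma num_lattice_points_dilate0 : num_lattice_points (dilate 0 P) = 1%N.
Proof.
have [//||_] := @card_fset_setE _ (dilate 0 P `&` @lattice R d) [:: 0]; last by [].
move=> x; rewrite inE; split=> [[[p Pp <-] _]|/eqP ->]; first by rewrite scale0r eqxx.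
split; first by exists 0; [exact: nbhs_singleton | rewrite scaler0].
by apply/mxOverP => i j; rewrite mxE.
Qed.

(* The lattice points of [dilate m P] and of its interior are counted along [y]
   and along [- y] in both possible ways; averaging the two values of the
   functional turns ceilings minus floors into the number of non-integers. *)
Lemma functional_box_heights y N (wf wb : nat -> R) kappa :
  generic W y ->
  (forall k, (k <= d)%N ->
    \sum_(0 <= m < N.+1) (wf m * (simplex_count d m k)%:R + wb m * bnd_count R d m k)
    = kappa * (k%:R + k%:R - d%:R)) ->
  \sum_(0 <= m < N.+1) (wf m * (num_lattice_points (dilate m P))%:R
                        + wb m * (num_boundary_points P m)%:R)
  = kappa * \sum_(r <- box_heights W c y) (r \isn't a Num.int)%:R.
Proof.
move=> gy fun_k; have gny := genericN gy.
have hE r : r \in box_heights W c y -> exists k l : nat, [/\ Num.ceil r = k :> int,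
    Num.floor r = l :> int, (l <= k <= d)%N & ((r \isn't a Num.int) + l = k)%N].
  move=> /mem_box_heights[S [p [ST pB rE]]]; have bS := triangulation_basis ST.
  have r0 : 0 <= r by rewrite rE; exact: box_height_ge0 pB.
  have rd : r <= d%:R by rewrite rE; exact: box_height_le bS pB.
  have f0 : 0 <= Num.floor r by rewrite floor_ge0.
  have cd : Num.ceil r <= d%:Z by rewrite ceil_le_int.
  have cf := ceil_floor r; exists `|Num.ceil r|%N, `|Num.floor r|%N.
  move: (Num.ceil r) (Num.floor r) f0 cd cf => k l l0 kd kl.
  by case: (r \isn't a Num.int) kl => /= kl; split; lia.
(* [F r] is the shift for the dilates; the interiors must have the reciprocal shift [(d - F r).+1]
   for [bnd_count] to apply. *)
have key (F : R -> nat) : (forall r, r \in box_heights W c y -> (F r <= d)%N) ->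
    (forall m, num_lattice_points (dilate m P) =
      (\sum_(r <- box_heights W c y) simplex_count d m (F r))%N) ->
    (forall m, (0 < m)%N -> num_lattice_points (dilate m P)° =
      (\sum_(r <- box_heights W c y) simplex_count d m (d - F r).+1)%N) ->
    \sum_(0 <= m < N.+1) (wf m * (num_lattice_points (dilate m P))%:R
                          + wb m * (num_boundary_points P m)%:R)
    = kappa * \sum_(r <- box_heights W c y) ((F r)%:R + (F r)%:R - d%:R).
  move=> Fd hf hi; rewrite mulr_sumr.
  transitivity (\sum_(r <- box_heights W c y) \sum_(0 <= m < N.+1)
      (wf m * (simplex_count d m (F r))%:R + wb m * bnd_count R d m (F r))); last first.
    by apply: eq_big_seq => r rs; exact: fun_k (Fd r rs).
  rewrite exchange_big /=.
  apply: eq_big_nat => m _; rewrite big_split /= -!mulr_sumr hf natr_sum; congr (_ + _ * _).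
  rewrite /bnd_count; have [->|m0] := posnP m.
    by rewrite -natr_sum -hf num_lattice_points_dilate0.
  by rewrite (num_boundary_pointsE m0 gy) hf hi // !natr_sum -sumrB.
have fE1 m := (count_dilate m gy).2; have fE2 m := (count_dilate m gny).2.
have iE1 m (m0 : (0 < m)%N) := (count_interior m0 gy).2.
have iE2 m (m0 : (0 < m)%N) := (count_interior m0 gny).2.
have opp r : r \in box_heights W c y -> Num.ceil (d%:R - r) = (d - `|Num.floor r|)%N :> int /\
    Num.floor (d%:R - r) = (d - `|Num.ceil r|)%N :> int.
  move=> /hE[k [l [ck fl kl _]]].
  rewrite ceilDzr ?floorDzr ?natr_int // -[d%:R]/((d%:Z)%:~R) intrKceil intrKfloor.
  by rewrite [Num.ceil (- r)]ceilNfloor [Num.floor (- r)]floorNceil !opprK ck fl; split; lia.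
(* A single direction gives the shifts ceil r and floor r + 1, which are not reciprocal for
   non-integral [r]. Counting dilates along one direction and interiors along the opposite one makes
   them so. *)
have e1 := key (fun r => `|Num.ceil r|%N).
have e2 := key (fun r => d - `|Num.floor r|)%N.
set E := \sum_(0 <= m < N.+1) _ in e1 e2 *.
have {}e1 : E = kappa * \sum_(r <- box_heights W c y) (`|Num.ceil r|%:R + `|Num.ceil r|%:R - d%:R).
  apply: e1 => [r /hE[k [l [-> _ /andP[] //]]]|m|m m0]; first exact: fE1.
  rewrite iE2 // big_box_heights_opp //; apply: eq_big_seq => r /opp[_ ->].
  by congr simplex_count.
have {}e2 : E = kappa * \sum_(r <- box_heights W c y)
    ((d - `|Num.floor r|)%:R + (d - `|Num.floor r|)%:R - d%:R).
  apply: e2 => [r _|m|m m0]; first by rewrite leq_subr.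
    by rewrite fE2 big_box_heights_opp //; apply: eq_big_seq => r /opp[-> _].
  rewrite iE1 //; apply: eq_big_seq => r /hE[k [l [_ -> /andP[lk kd] _]]] /=.
  by rewrite subKn // (leq_trans lk).
have two : 2 * E = 2 * (kappa * \sum_(r <- box_heights W c y) (r \isn't a Num.int)%:R).
  transitivity (E + E); first by ring.
  rewrite {1}e1 {}e2 -mulrDr -big_split /= [RHS]mulrCA; congr (_ * _).
  rewrite mulr_sumr; apply: eq_big_seq => r /hE[k [l [-> -> /andP[lk kd] <-]]] /=.
  rewrite natrB ?(leq_trans lk) // natrD; ring.
by apply: (mulfI _ two); rewrite pnatr_eq0.
Qed.

End Counts.

(** The hull is described by its minimality among convex sets, so that no explicit convex
    combinations are needed. *)
Lemma lattice_polytope_gens (R : realType) (d : nat) (P : set 'rV[R]_d) :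
  lattice_polytope P -> exists n (W : 'M[R]_(n, d)),
  [/\ W \is a mxOver Num.int, @convex_set R 'rV[R]_d P, forall i, P (row i W) &
    forall C : set 'rV[R]_d,
      @convex_set R 'rV[R]_d C -> (forall i, C (row i W)) -> P `<=` C].
Proof.
move=> [V [fV VL ->]]; pose s : seq 'rV[R]_d := fset_set V.
have sV v : v \in s = (v \in V) by rewrite in_fset_set.
pose W : 'M[R]_(size s, d) := \matrix_i nth 0 s i.
have VW i : V (row i W) by rewrite rowK; apply/set_mem; rewrite -sV mem_nth.
exists (size s), W; split.
- by apply/mxOverP => i j; have /VL/mxOverP/(_ 0 j) := VW i; rewrite mxE.
- apply/convexP => x y t t01 hx hy C [cC VC].
  by apply: (convexP C).1 => //; [exact: hx | exact: hy].
- by move=> i; exact: sub_gen_smallest.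
- move=> C cC CW; apply: smallest_sub => // v /mem_set; rewrite -sV => vs.
  by have := CW (Ordinal (etrans (index_mem v s) vs)); rewrite rowK nth_index.
Qed.

(* [uphalf d] is the ceiling of d/2. *)
Theorem theorem3p7 (R : realType) (d : nat) (P : set 'rV[R]_d) (N : nat)
  (hP : fano P) (hN : N = uphalf d) :
  (~~ odd d ->
     (reflexive_polytope P <->
      \sum_(0 <= m < N.+1)
        (-1) ^+ (N + m) * 'C(2 * N, N + m)%:R *
        (d%:R * (num_lattice_points (dilate m P))%:R
         - (N + m)%:R * (num_boundary_points P m)%:R) = 0 :> R))
  /\
  (odd d ->
     (reflexive_polytope P <->
      \sum_(0 <= m < N.+1)
        (-1) ^+ (N + m) * 'C(2 * N, N + m)%:R *
        (m%:R * d%:R * (num_lattice_points (dilate m P))%:R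
         + (N%:R ^+ 2 - m%:R ^+ 2 - m%:R * d%:R / 2)
           * (num_boundary_points P m)%:R) = 0 :> R)).
Proof.
have [/lattice_polytope_gens[n [W [W_int P_convex P_gen P_min]]] _ int0] := hP.
have P_nbhs0 : nbhs (0 : 'rV[R]_d) P.
  by have [] : (P° `&` @lattice R d) 0 by rewrite int0.
have [c c_ok] := exists_weight W; have [y y_gen] := exists_generic W.
have reflP : reflexive_polytope P <->
    \sum_(r <- box_heights W c y) (r \isn't a Num.int)%:R = 0 :> R.
  have dualP := dual_lattice_polytopeP W_int P_convex P_gen P_min P_nbhs0 c_ok y_gen.
  split=> [[_ /dualP hint]|/eqP]; first by rewrite big_seq big1 // => r /hint ->.
  rewrite psumr_eq0 // => /allP h; split=> //; apply/dualP => r /h.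
  by rewrite pnatr_eq0; case: (r \is a Num.int).
have reduce wf wb kappa : (d == 0%N) || (kappa != 0) ->
    (forall k, (k <= d)%N ->
      \sum_(0 <= m < N.+1) (wf m * (simplex_count d m k)%:R + wb m * bnd_count R d m k)
      = kappa * (k%:R + k%:R - d%:R)) ->
    reflexive_polytope P <->
    \sum_(0 <= m < N.+1) (wf m * (num_lattice_points (dilate m P))%:R
      + wb m * (num_boundary_points P m)%:R) = 0.
  move=> kappa0 /(functional_box_heights W_int P_convex P_gen P_min P_nbhs0 c_ok y_gen) ->.
  apply: (iff_trans reflP); split=> [->|/eqP]; first by rewrite mulr0.
  rewrite mulf_eq0; case/orP: kappa0 => [/eqP d0 _|/negbTE -> /eqP //].
  (* In dimension 0 the factor [kappa] may vanish, but box heights are squeezed between 0 and [d],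
     so none is fractional. *)
  rewrite big_seq big1 // => r /mem_box_heights[S [p [/triangulation_basis bS pB ->]]].
  suff -> : height W S p = 0 by rewrite rpred0.
  apply/eqP; rewrite eq_le (box_height_ge0 pB) andbT.
  by have := box_height_le bS pB; rewrite [X in _ <= X%:R]d0.
split=> od.
  have dN : d = N.*2 by lia.
  pose w m : R := (-1) ^+ (N + m) * 'C(2 * N, N + m)%:R.
  have [|k kd|h1 h2] := reduce (fun m => w m * d%:R) (fun m => - (w m * (N + m)%:R)) (d%:R / 2).
  - by rewrite mulf_eq0 invr_eq0 !pnatr_eq0 orbF orbN.
  - rewrite -(functional_even R dN kd); apply: eq_bigr => m _.
    by rewrite /w; ring.
  - rewrite (eq_bigr (fun m => w m * d%:R * (num_lattice_points (dilate m P))%:R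
        + - (w m * (N + m)%:R) * (num_boundary_points P m)%:R)) //.
    by move=> m _; rewrite /w; ring.
have dN : d.+1 = N.*2 by lia.
pose w m : R := (-1) ^+ (N + m) * 'C(2 * N, N + m)%:R.
have [|k kd|h1 h2] := reduce (fun m => w m * (m%:R * d%:R))
  (fun m => w m * (N%:R ^+ 2 - m%:R ^+ 2 - m%:R * d%:R / 2)) (d%:R * (d%:R + 1) / 2).
- by rewrite !mulf_eq0 invr_eq0 natr1 !pnatr_eq0 !orbF orbN.
- by rewrite -(functional_odd R dN kd); apply: eq_bigr => m _; rewrite /w; ring.
- rewrite (eq_bigr (fun m => w m * (m%:R * d%:R) * (num_lattice_points (dilate m P))%:R
      + w m * (N%:R ^+ 2 - m%:R ^+ 2 - m%:R * d%:R / 2) * (num_boundary_points P m)%:R)) //.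
  by move=> m _; rewrite /w; ring.
Qed.
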